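(* Let $X$ and $Y$ be connected, locally path-connected, semilocally simply-connected topological spaces, let $f:X\to Y$ be continuous, let $x_0\in X$ and $y_0:=f(x_0)$, and let $f_{\sharp}:\pi_1(X,x_0)\to G:=\pi_1(Y,y_0)$ be the induced homomorphism. Then the topological pullback functor $f^{\ast}$ has nullity zero if and only if $H:=\operatorname{Im} f_{\sharp}$ is contranormal in $G$.
   Context: Spaces are not required to be Hausdorff. $\mathrm{Cov}(Y)$ is the category of unbased coverings $p:E\to Y$ ($E$ may be disconnected or empty); a morphism from $p_1:E_1\to Y$ to $p_2:E_2\to Y$ is a continuous map $t:E_1\to E_2$ with $p_1=p_2\circ t$. The topological pullback functor $f^{\ast}:\mathrm{Cov}(Y)\to\mathrm{Cov}(X)$ sends $p:E\to Y$ to $f^{\ast}(p):f^{\ast}(E)\to X$, where $f^{\ast}(E):=\{(x,e)\in X\times E\mid f(x)=p(e)\}$ (a subspace of $X\times E$) and $f^{\ast}(p)$ is the restriction of the projection to $X$; it sends a morphism $t$ to the restriction of $\mathrm{id}_X\times t$. A covering of $Y$ is trivial if it is isomorphic in $\mathrm{Cov}(Y)$ to a disjoint union $c\cdot Y$ of $c$ copies of the one-sheeted cover $\mathrm{id}:Y\to Y$, for some cardinal number $c$ (similarly for $X$). The functor $f^{\ast}$ has nullity zero provided that for every covering $E$ of $Y$, if $f^{\ast}(E)$ is trivial then $E$ is trivial. A subgroup $L$ of $G$ is contranormal in $G$ if the normal closure of $L$ in $G$ (the subgroup generated by all $g^{-1}Lg$, $g\in G$) equals $G$. *)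

(* Defs.v *)
From HB Require Import structures.
From mathcomp Require Import all_boot all_order all_algebra generic_quotient.
From mathcomp Require Import all_classical all_reals all_analysis.
From mathcomp Require Import homotopy ring lra.

Set Implicit Arguments.
Unset Strict Implicit.
Unset Printing Implicit Defensive.

Import Order.TTheory GRing.Theory Num.Theory.
Import numFieldNormedType.Exports.

Local Open Scope classical_set_scope.
Local Open Scope ring_scope.
Local Open Scope quotient_scope.

Definition set_in (T : Type) (A : set T) (x : T) (Ax : x \in A) : set_type A :=
  exist (fun y => is_true (y \in A)) x Ax.

Lemma continuous_set_val (T : topologicalType) (A : set T) :
  continuous (@set_val T A).
Proof. exact: initial_continuous. Qed.

Lemma continuous_set_type (S T : topologicalType) (A : set T)
    (f : S -> set_type A) :
  continuous (fun s => set_val (f s)) -> continuous f.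
Proof. by move=> cf; apply: continuous_comp_initial. Qed.

Definition homeomorphism (S T : topologicalType) (h : S -> T) : Prop :=
  continuous h /\
  exists g : T -> S, [/\ continuous g, cancel h g & cancel g h].

Lemma continuous_fst (S T : topologicalType) : continuous (@fst S T).
Proof. by move=> x; exact: cvg_fst. Qed.

Lemma continuous_snd (S T : topologicalType) : continuous (@snd S T).
Proof. by move=> x; exact: cvg_snd. Qed.

Lemma continuous_pair (S T U : topologicalType) (f : S -> T) (g : S -> U) :
  continuous f -> continuous g -> continuous (fun s => (f s, g s)).
Proof. by move=> cf cg s; apply: cvg_pair; [exact: cf|exact: cg]. Qed.

Lemma continuous_compT (S T U : topologicalType) (f : S -> T) (g : T -> U) :
  continuous f -> continuous g -> continuous (fun s => g (f s)).
Proof. by move=> cf cg s; apply: continuous_comp; [exact: cf|exact: cg]. Qed.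

Definition restricts_to_homeomorphism (E Y : topologicalType) (p : E -> Y)
    (V : set E) (U : set Y) : Prop :=
  exists2 h : set_type V -> set_type U,
    homeomorphism h & forall v, set_val (h v) = p (set_val v).

Definition evenly_covered (E Y : topologicalType) (p : E -> Y) (U : set Y) :=
  exists F : set (set E),
    [/\ forall V, F V -> open V,
        trivIset F id,
        \bigcup_(V in F) V = p @^-1` U &
        forall V, F V -> restricts_to_homeomorphism p V U].

(* A covering need not be surjective: the family of sheets may be empty. *)
Definition is_covering (E Y : topologicalType) (p : E -> Y) : Prop :=
  continuous p /\
  forall y : Y, exists2 U : set Y, open_nbhs y U & evenly_covered p U.

Record cov (Y : topologicalType) := Cov {
  cov_total :> topologicalType;
  cov_proj : cov_total -> Y;
  cov_projP : is_covering cov_proj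
}.

Record cov_mor (Y : topologicalType) (E1 E2 : cov Y) := CovMor {
  cov_map :> E1 -> E2;
  cov_map_continuous : continuous cov_map;
  cov_mapP : forall e, cov_proj e = cov_proj (cov_map e)
}.

Definition cov_id (Y : topologicalType) (E : cov Y) : cov_mor E E :=
  @CovMor Y E E id (fun e => @cvg_id E (nbhs e)) (fun=> erefl).

Lemma cov_comp_subproof (Y : topologicalType) (E1 E2 E3 : cov Y)
    (s : cov_mor E2 E3) (t : cov_mor E1 E2) (e : E1) :
  cov_proj e = cov_proj (s (t e)).
Proof. by rewrite -!cov_mapP. Qed.

Definition cov_comp (Y : topologicalType) (E1 E2 E3 : cov Y)
    (s : cov_mor E2 E3) (t : cov_mor E1 E2) : cov_mor E1 E3 :=
  CovMor (continuous_compT (@cov_map_continuous _ _ _ t)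
                           (@cov_map_continuous _ _ _ s))
         (cov_comp_subproof s t).

Definition cov_iso (Y : topologicalType) (E1 E2 : cov Y) : Prop :=
  exists (t : cov_mor E1 E2) (s : cov_mor E2 E1),
    cov_comp s t =1 cov_id E1 /\ cov_comp t s =1 cov_id E2.

Section DisjointCopies.
Variables (Y : topologicalType) (C : choiceType).

Definition copies : topologicalType := {_ : C & Y}.

Definition copies_proj (e : copies) : Y := projT2 e.

Lemma copies_proj_continuous : continuous copies_proj.
Proof.
apply/continuousP => A oA; apply/sigT_openP => i.
by rewrite (_ : _ @^-1` _ = A).
Qed.

Lemma copies_covering : is_covering copies_proj.
Proof.
split; first exact: copies_proj_continuous.
move=> y; exists setT; first exact: open_nbhsT.
pose sheet (i : C) : set copies := [set e | projT1 e = i].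
exists (range sheet); split.
- move=> _ [i _ <-]; apply/sigT_openP => j.
  have [ij|ij] := pselect (j = i).
    by rewrite (_ : _ @^-1` _ = setT) ?predeqE//; exact: openT.
  by rewrite (_ : _ @^-1` _ = set0) ?predeqE//; exact: open0.
- by move=> _ _ [i _ <-] [j _ <-] [e [/= ei ej]]; rewrite -ei -ej.
- by rewrite predeqE => e; split => // _; exists (sheet (projT1 e)).
- move=> _ [i _ <-].
  have inT (z : Y) : z \in [set: Y] by rewrite inE.
  have inS (z : Y) : (existT _ i z : copies) \in sheet i by rewrite inE.
  exists (fun v : set_type (sheet i) =>
            set_in (inT (copies_proj (set_val v)))) => //.
  split.
    apply: continuous_set_type => /=.
    by apply: (continuous_compT _ copies_proj_continuous);
       exact: continuous_set_val.
  exists (fun z : set_type setT =>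
            set_in (inS (set_val z))).
  split.
  + apply: continuous_set_type => /=.
    apply: (@continuous_compT _ _ _ _ (fun z : Y => existT _ i z : copies)).
      exact: continuous_set_val.
    exact: existT_continuous.
  + move=> [[j z] jz]; apply: val_inj => /=.
    by move: (jz); rewrite inE /sheet /= => <-.
  + by move=> [z zT]; exact: val_inj.
Qed.

Definition cov_copies : cov Y := Cov copies_covering.

End DisjointCopies.

(* The cardinal number c is represented by an arbitrary set C of indices. *)
Definition trivial_cov (Y : topologicalType) (E : cov Y) : Prop :=
  exists C : choiceType, cov_iso E (cov_copies Y C).

Section Pullback.
Variables (X Y : topologicalType) (f : continuousType X Y).

Definition pullback_total (E : cov Y) : topologicalType :=
  set_type [set xe : X * E | f xe.1 = cov_proj xe.2].

Definition pullback_proj (E : cov Y) (z : pullback_total E) : X :=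
  (set_val z).1.

Lemma pullback_proj_continuous (E : cov Y) : continuous (@pullback_proj E).
Proof.
apply: (@continuous_compT _ _ _ _ (@fst X E)); last exact: continuous_fst.
exact: continuous_set_val.
Qed.

Lemma pullback_snd_continuous (E : cov Y) :
  continuous (fun z : pullback_total E => (set_val z).2).
Proof.
apply: (@continuous_compT _ _ _ _ (@snd X E)); last exact: continuous_snd.
exact: continuous_set_val.
Qed.

Lemma pullback_covering (E : cov Y) : is_covering (@pullback_proj E).
Proof.
split; first exact: pullback_proj_continuous.
move=> x; have [cp /(_ (f x))[U [oU Ufx] [F [Fo Ft FU Fh]]]] := cov_projP E.
have cf : continuous f := @cts_fun _ _ f.
have zP (z : pullback_total E) : f (set_val z).1 = cov_proj (set_val z).2.
  by have := set_valP z.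
exists (f @^-1` U).
  by split => //; move/continuousP: cf; exact.
pose sh (V : set E) : set (pullback_total E) := [set z | V (set_val z).2].
exists (sh @` F); split.
- move=> _ [V FV <-].
  by have /continuousP := @pullback_snd_continuous E; apply; exact: Fo.
- move=> _ _ [V FV <-] [W FW <-] [z [/= Vz Wz]]; congr sh.
  by apply: Ft => //; exists (set_val z).2.
- rewrite predeqE => z; split=> [[_ [V FV <-] /= Vz]|/= Uz].
    rewrite /pullback_proj zP.
    have : (\bigcup_(V in F) V) (set_val z).2 by exists V.
    by rewrite FU.
  have : (\bigcup_(V in F) V) (set_val z).2.
    by rewrite FU /= -zP.
  by move=> [V FV Vz]; exists (sh V) => //; exists V.
- move=> _ [V FV <-]; have [h [ch [g [cg hg gh]]] hp] := Fh _ FV.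
  have inU (v : set_type (sh V)) : pullback_proj (set_val v) \in f @^-1` U.
    rewrite inE /= /pullback_proj zP.
    have : (\bigcup_(V in F) V) (set_val (set_val v)).2.
      by exists V => //; exact: (set_valP v).
    by rewrite FU.
  exists (fun v : set_type (sh V) =>
     set_in (inU v)) => //.
  have inU' (u : set_type (f @^-1` U)) : f (set_val u) \in U.
    by rewrite inE; exact: (set_valP u).
  pose fu (u : set_type (f @^-1` U)) : set_type U := set_in (inU' u).
  have inP (u : set_type (f @^-1` U)) : (set_val u, set_val (g (fu u)))
      \in [set xe : X * E | f xe.1 = cov_proj xe.2].
    by rewrite inE /= -hp gh.
  pose k0 u : pullback_total E := set_in (inP u).
  have inS (u : set_type (f @^-1` U)) : k0 u \in sh V.
    by rewrite inE /sh /=; exact: (set_valP (g (fu u))).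
  split.
    apply: continuous_set_type => /=.
    apply: (@continuous_compT _ _ _ _ (@pullback_proj E)).
      exact: continuous_set_val.
    exact: pullback_proj_continuous.
  exists (fun u => set_in (inS u)).
  split.
  + apply: continuous_set_type; apply: continuous_set_type => /=.
    apply: continuous_pair; first exact: continuous_set_val.
    apply: continuous_compT; last exact: continuous_set_val.
    apply: continuous_compT; last exact: cg.
    apply: continuous_set_type => /=.
    by apply: continuous_compT cf; exact: continuous_set_val.
  + move=> v; apply: val_inj; apply: val_inj => /=.
    have inV : (set_val (set_val v)).2 \in V.
      by rewrite inE; exact: (set_valP v).
    rewrite [RHS]surjective_pairing; congr pair.
    rewrite (_ : fu _ = h (set_in inV)) ?hg//.
    by apply: val_inj; rewrite /= [RHS]hp -zP.
  + by move=> u; exact: val_inj.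
Qed.

Definition pullback_cov (E : cov Y) : cov X := Cov (@pullback_covering E).

Section PullbackMor.
Variables (E1 E2 : cov Y) (t : cov_mor E1 E2).

Lemma pullback_map_subproof (z : pullback_cov E1) :
  ((set_val z).1, t (set_val z).2)
    \in [set xe : X * E2 | f xe.1 = cov_proj xe.2].
Proof. by rewrite inE /= -cov_mapP; exact: (set_valP z). Qed.

Definition pullback_map (z : pullback_cov E1) : pullback_cov E2 :=
  set_in (pullback_map_subproof z).

Lemma pullback_map_continuous : continuous pullback_map.
Proof.
apply: continuous_set_type; apply: continuous_pair.
  exact: pullback_proj_continuous.
apply: continuous_compT (@cov_map_continuous _ _ _ t).
exact: pullback_snd_continuous.
Qed.

Lemma pullback_mapP (z : pullback_cov E1) :
  cov_proj z = cov_proj (pullback_map z).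
Proof. by []. Qed.

Definition pullback_mor : cov_mor (pullback_cov E1) (pullback_cov E2) :=
  CovMor pullback_map_continuous pullback_mapP.

End PullbackMor.

Lemma pullback_mor_id (E : cov Y) :
  pullback_mor (cov_id E) =1 cov_id (pullback_cov E).
Proof. by move=> z; apply: val_inj; rewrite /= -surjective_pairing. Qed.

Lemma pullback_mor_comp (E1 E2 E3 : cov Y) (s : cov_mor E2 E3)
    (t : cov_mor E1 E2) :
  pullback_mor (cov_comp s t) =1 cov_comp (pullback_mor s) (pullback_mor t).
Proof. by move=> z; exact: val_inj. Qed.

Definition nullity_zero : Prop :=
  forall E : cov Y, trivial_cov (pullback_cov E) -> trivial_cov E.

End Pullback.

Section UnitInterval.
Variable R : realType.

Definition unitI : Type := set_type `[0 : R, 1].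

HB.instance Definition _ := Topological.on unitI.

Lemma unitI0_subproof : (0 : R) \in [set` `[0 : R, 1]].
Proof. by rewrite inE /= in_itv /= lexx ler01. Qed.

Lemma unitI1_subproof : (1 : R) \in [set` `[0 : R, 1]].
Proof. by rewrite inE /= in_itv /= lexx ler01. Qed.

Lemma unitI_neq_subproof :
  (set_in unitI0_subproof : unitI) != set_in unitI1_subproof.
Proof. by apply/eqP => /(congr1 val) /= /eqP; rewrite eq_sym oner_eq0. Qed.

HB.instance Definition _ :=
  @isBiPointed.Build unitI _ _ unitI_neq_subproof.

Definition ival (t : unitI) : R := set_val t.

Lemma ival_continuous : continuous ival.
Proof. exact: continuous_set_val. Qed.

Lemma ival_inj : injective ival.
Proof. exact: val_inj. Qed.

Lemma ival_ge0 (t : unitI) : 0 <= ival t.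
Proof. by have := set_valP t; rewrite /= in_itv => /andP[]. Qed.

Lemma ival_le1 (t : unitI) : ival t <= 1.
Proof. by have := set_valP t; rewrite /= in_itv => /andP[]. Qed.

Lemma ival0 : ival zero = 0. Proof. by []. Qed.

Lemma ival1 : ival one = 1. Proof. by []. Qed.

Lemma clamp_subproof (r : R) :
  Num.max 0 (Num.min 1 r) \in [set` `[0 : R, 1]].
Proof.
by rewrite inE /= in_itv /= le_max lexx /= ge_max ler01 ge_min lexx.
Qed.

(* The retraction of the real line onto the unit interval. *)
Definition clamp (r : R) : unitI := set_in (clamp_subproof r).

Lemma clampK (r : R) : 0 <= r -> r <= 1 -> ival (clamp r) = r.
Proof.
by move=> r0 r1; rewrite /ival /= set_valE /= min_r// max_r.
Qed.

Lemma ivalK : cancel ival clamp.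
Proof.
by move=> t; apply: ival_inj; rewrite clampK ?ival_ge0 ?ival_le1.
Qed.

Lemma clamp_ge1 (r : R) : 1 <= r -> clamp r = one.
Proof.
move=> r1; apply: ival_inj; rewrite ival1 /ival set_valE /= min_l//.
by rewrite max_r.
Qed.

Lemma clamp_le0 (r : R) : r <= 0 -> clamp r = zero.
Proof.
move=> r0; apply: ival_inj; rewrite ival0 /ival set_valE /=.
by rewrite max_l// ge_min r0 orbT.
Qed.

Lemma clamp_continuous : continuous clamp.
Proof.
apply: continuous_set_type => r.
apply: (@continuous_max _ _ (cst 0) (fun r : R => Num.min 1 r)).
  exact: cvg_cst.
by apply: (@continuous_min _ _ (cst 1) id); [exact: cvg_cst|exact: cvg_id].
Qed.

End UnitInterval.

Section RealContinuity.
Variables (R : realType) (S : topologicalType).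
Implicit Types f g : S -> R.

Lemma continuous_addR f g :
  continuous f -> continuous g -> continuous (fun s => f s + g s).
Proof. by move=> cf cg s; apply: cvgD; [exact: cf|exact: cg]. Qed.

Lemma continuous_subR f g :
  continuous f -> continuous g -> continuous (fun s => f s - g s).
Proof. by move=> cf cg s; apply: cvgB; [exact: cf|exact: cg]. Qed.

Lemma continuous_mulR f g :
  continuous f -> continuous g -> continuous (fun s => f s * g s).
Proof. by move=> cf cg s; apply: cvgM; [exact: cf|exact: cg]. Qed.

Lemma continuous_minR f g :
  continuous f -> continuous g -> continuous (fun s => Num.min (f s) (g s)).
Proof. by move=> cf cg s; exact: (continuous_min (cf s) (cg s)). Qed.

Lemma continuous_maxR f g :
  continuous f -> continuous g -> continuous (fun s => Num.max (f s) (g s)).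
Proof. by move=> cf cg s; exact: (continuous_max (cf s) (cg s)). Qed.

Lemma continuous_cstR (r : R) : continuous (fun _ : S => r).
Proof. by move=> ?; exact: cvg_cst. Qed.

Lemma continuous_ivalR (f : S -> unitI R) :
  continuous f -> continuous (fun s => ival (f s)).
Proof. by move=> cf; exact: continuous_compT cf (@ival_continuous R). Qed.

Lemma continuous_clampR f : continuous f -> continuous (fun s => clamp (f s)).
Proof. by move=> cf; exact: continuous_compT cf (@clamp_continuous R). Qed.

Lemma continuous_paste (T : topologicalType) (a : S -> R) (c : R)
    (u v : S -> T) :
  continuous a -> continuous u -> continuous v ->
  (forall s, a s = c -> u s = v s) ->
  continuous (fun s => if a s <= c then u s else v s).
Proof.
move=> ca cu cv uv; apply/continuous_closedP => A cA.
rewrite (_ : _ @^-1` A = (a @^-1` [set r | r <= c] `&` u @^-1` A) `|`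
                         (a @^-1` [set r | c <= r] `&` v @^-1` A)); last first.
  rewrite predeqE => s /=; have [ac|ac|ac] := ltgtP (a s) c.
  - by split=> [?|[[]//|[]//]]; left.
  - by split=> [?|[[]//|[]//]]; right.
  - by split=> [?|[[]//|[_]]]; [left|rewrite uv].
apply: closedU; apply: closedI.
- by move/continuous_closedP: ca; apply; exact: closed_le.
- by move/continuous_closedP: cu; apply.
- by move/continuous_closedP: ca; apply; exact: closed_ge.
- by move/continuous_closedP: cv; apply.
Qed.

End RealContinuity.

Ltac cont := repeat lazymatch goal with |- continuous ?F =>
  lazymatch F with
  | (fun _ => ?c) => by apply: continuous_cstR
  | (fun _ => (_, _)) => apply: continuous_pair
  | (fun _ => clamp _) => apply: continuous_clampR
  | (fun _ => ival _) => apply: continuous_ivalR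
  | (fun _ => _ - _) => apply: continuous_subR
  | (fun _ => _ + _) => apply: continuous_addR
  | (fun _ => _ * _) => apply: continuous_mulR
  | (fun _ => Order.min _ _) => apply: continuous_minR
  | (fun _ => Order.max _ _) => apply: continuous_maxR
  | (fun z => z) => by move=> ?; exact: cvg_id
  | (fun z => z.1) => exact: continuous_fst
  | (fun z => z.2) => exact: continuous_snd
  | fst => exact: continuous_fst
  | snd => exact: continuous_snd
  | @ival _ => exact: ival_continuous
  | _ => exact: cts_fun
  end end.

Section Paths.
Variables (R : realType) (T : topologicalType).
Local Notation I := (unitI R).

Definition homotopic (x y : T) (p q : {path I from x to y}) : Prop :=
  exists H : I * I -> T,
    [/\ continuous H,
        forall t, H (t, zero) = p t,
        forall t, H (t, one) = q t,
        forall s, H (zero, s) = x &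
        forall s, H (one, s) = y].

Lemma homotopic_refl (x y : T) (p : {path I from x to y}) : homotopic p p.
Proof.
exists (fun z => p z.1); split=> //=; last 2 first.
- by move=> _; exact: path_zero.
- by move=> _; exact: path_one.
by apply: continuous_compT; cont.
Qed.

Lemma homotopic_sym (x y : T) (p q : {path I from x to y}) :
  homotopic p q -> homotopic q p.
Proof.
move=> [H [cH H0 H1 Hx Hy]].
exists (fun z => H (z.1, clamp (1 - ival z.2))); split=> /=.
- by apply: continuous_compT cH; cont.
- by move=> t; rewrite ival0 subr0 clamp_ge1.
- by move=> t; rewrite ival1 subrr clamp_le0.
- by move=> s; rewrite Hx.
- by move=> s; rewrite Hy.
Qed.

Lemma homotopic_trans (x y : T) (q p r : {path I from x to y}) :
  homotopic p q -> homotopic q r -> homotopic p r.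
Proof.
move=> [H [cH H0 H1 Hx Hy]] [K [cK K0 K1 Kx Ky]].
exists (fun z => if ival z.2 <= 2^-1 then H (z.1, clamp (2 * ival z.2))
                 else K (z.1, clamp (2 * ival z.2 - 1))); split=> /=.
- apply: continuous_paste; first by cont.
  + by apply: continuous_compT cH; cont.
  + by apply: continuous_compT cK; cont.
  + by move=> z ->; rewrite divff// subrr clamp_ge1// clamp_le0// H1 K0.
- by move=> t; rewrite ival0 invr_ge0 ler0n mulr0 clamp_le0.
- move=> t; rewrite ival1 ifF; last by apply/negbTE; rewrite -ltNge; lra.
  by rewrite clamp_ge1//; lra.
- by move=> s; case: ifP.
- by move=> s; case: ifP.
Qed.

Section Concat.
Variables (x y z : T) (p : {path I from x to y}) (q : {path I from y to z}).

(* The library's chain_path is defined on a wedge of two intervals; the product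
   of paths is parametrized by a single one. *)
Definition concat (t : I) : T :=
  if ival t <= 2^-1 then p (clamp (2 * ival t)) else q (clamp (2 * ival t - 1)).

Lemma concat_continuous : continuous concat.
Proof.
apply: continuous_paste; first by cont.
- by apply: (@continuous_compT _ _ _ _ p); cont.
- by apply: (@continuous_compT _ _ _ _ q); cont.
- move=> t ->; rewrite divff// subrr clamp_ge1// clamp_le0//.
  by rewrite path_zero path_one.
Qed.

Lemma concat_zero : concat zero = x.
Proof.
by rewrite /concat ival0 invr_ge0 ler0n mulr0 clamp_le0// path_zero.
Qed.

Lemma concat_one : concat one = z.
Proof.
rewrite /concat ival1 ifF; last by apply/negbTE; rewrite -ltNge; lra.
by rewrite clamp_ge1 ?path_one//; lra.
Qed.

HB.instance Definition _ := isContinuous.Build I T concat concat_continuous.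
HB.instance Definition _ := isPath.Build I T x z concat concat_zero concat_one.

End Concat.

Section Reverse.
Variables (x y : T) (p : {path I from x to y}).

Definition reverse (t : I) : T := p (clamp (1 - ival t)).

Lemma reverse_continuous : continuous reverse.
Proof. by apply: (@continuous_compT _ _ _ _ p); cont. Qed.

Lemma reverse_zero : reverse zero = y.
Proof. by rewrite /reverse ival0 subr0 clamp_ge1// path_one. Qed.

Lemma reverse_one : reverse one = x.
Proof. by rewrite /reverse ival1 subrr clamp_le0// path_zero. Qed.

HB.instance Definition _ := isContinuous.Build I T reverse reverse_continuous.
HB.instance Definition _ :=
  isPath.Build I T y x reverse reverse_zero reverse_one.

End Reverse.

Lemma homotopic_concat (x y z : T) (p p' : {path I from x to y})
    (q q' : {path I from y to z}) :
  homotopic p p' -> homotopic q q' -> homotopic (concat p q) (concat p' q').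
Proof.
move=> [H [cH H0 H1 Hx Hy]] [K [cK K0 K1 Kx Ky]].
exists (fun z => if ival z.1 <= 2^-1 then H (clamp (2 * ival z.1), z.2)
                 else K (clamp (2 * ival z.1 - 1), z.2)); split=> /=.
- apply: continuous_paste; first by cont.
  + by apply: continuous_compT cH; cont.
  + by apply: continuous_compT cK; cont.
  + by move=> w ->; rewrite divff// subrr clamp_ge1// clamp_le0// Hy Kx.
- by move=> t; rewrite H0 K0.
- by move=> t; rewrite H1 K1.
- by move=> s; rewrite ival0 invr_ge0 ler0n mulr0 clamp_le0.
- move=> s; rewrite ival1 ifF; last by apply/negbTE; rewrite -ltNge; lra.
  by rewrite clamp_ge1 ?Ky//; lra.
Qed.

Lemma homotopic_reverse (x y : T) (p q : {path I from x to y}) :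
  homotopic p q -> homotopic (reverse p) (reverse q).
Proof.
move=> [H [cH H0 H1 Hx Hy]].
exists (fun z => H (clamp (1 - ival z.1), z.2)); split=> /=.
- by apply: continuous_compT cH; cont.
- by move=> t; rewrite H0.
- by move=> t; rewrite H1.
- by move=> s; rewrite ival0 subr0 clamp_ge1.
- by move=> s; rewrite ival1 subrr clamp_le0.
Qed.

Lemma homotopic_reparam (x y : T) (p q : {path I from x to y}) (phi : I -> R) :
  continuous phi -> phi zero <= 0 -> 1 <= phi one ->
  (forall t, q t = p (clamp (phi t))) -> homotopic q p.
Proof.
move=> cphi phi0 phi1 qp.
exists (fun z => p (clamp ((1 - ival z.2) * phi z.1 + ival z.2 * ival z.1))).
split=> /=.
- apply: (@continuous_compT _ _ _ _ p); cont.
  by apply: continuous_compT cphi; cont.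
- by move=> t; rewrite ival0 subr0 mul1r mul0r addr0 qp.
- by move=> t; rewrite ival1 subrr mul0r mul1r add0r ivalK.
- move=> s; rewrite ival0 clamp_le0 ?path_zero//.
  by rewrite mulr0 addr0 mulr_ge0_le0// subr_ge0 ival_le1.
- move=> s; rewrite ival1 clamp_ge1 ?path_one//.
  have s1 : 0 <= 1 - ival s by rewrite subr_ge0 ival_le1.
  by have := ler_wpM2l s1 phi1; lra.
Qed.

Definition cst_path (x : T) : {path I from x to x} := cst x : I -> T.

Lemma concat_cstp (x y : T) (p : {path I from x to y}) :
  homotopic (concat (cst_path x) p) p.
Proof.
apply: (@homotopic_reparam _ _ _ _ (fun t => 2 * ival t - 1)).
- by cont.
- by rewrite ival0; lra.
- by rewrite ival1; lra.
- move=> t; rewrite /= /concat; case: ifP => // t2.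
  by rewrite (@clamp_le0 _ (2 * ival t - 1)) ?path_zero//; lra.
Qed.

Lemma concat_pcst (x y : T) (p : {path I from x to y}) :
  homotopic (concat p (cst_path y)) p.
Proof.
apply: (@homotopic_reparam _ _ _ _ (fun t => 2 * ival t)).
- by cont.
- by rewrite ival0; lra.
- by rewrite ival1; lra.
- move=> t; rewrite /= /concat; case: ifPn => //; rewrite -ltNge => t2.
  by rewrite (@clamp_ge1 _ (2 * ival t)) ?path_one//; lra.
Qed.

Lemma concat_assoc (x y z w : T) (p : {path I from x to y})
    (q : {path I from y to z}) (r : {path I from z to w}) :
  homotopic (concat (concat p q) r) (concat p (concat q r)).
Proof.
pose phi (t : I) := Num.min (2 * ival t)
  (Num.min (ival t + 4^-1) (2^-1 * ival t + 2^-1)) : R.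
apply: (@homotopic_reparam _ _ _ _ phi).
- by rewrite /phi; cont.
- by rewrite /phi ival0 ge_min mulr0 lexx.
- by rewrite /phi ival1 !le_min; apply/and3P; split; lra.
- move=> t; have t0 := ival_ge0 t; have t1 := ival_le1 t.
  rewrite /= /concat /= /concat.
  have [t2|t2] := leP (ival t) 2^-1.
  + rewrite (@clampK _ (2 * ival t)); [|lra..].
    have [t4|t4] := leP (2 * ival t) 2^-1.
    * have -> : phi t = 2 * ival t.
        by rewrite /phi min_l// le_min; apply/andP; split; lra.
      by rewrite clampK ?ifT//; lra.
    * have -> : phi t = ival t + 4^-1.
        rewrite /phi [X in Num.min _ X]min_l; last by lra.
        by rewrite min_r//; lra.
      rewrite clampK; [|lra..].
      have [?|_] := leP (ival t + 4^-1) 2^-1; first by exfalso; lra.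
      rewrite clampK; [|lra..].
      rewrite ifT; last by lra.
      by congr (q (clamp _)); lra.
  + have -> : phi t = 2^-1 * ival t + 2^-1.
      rewrite /phi [X in Num.min _ X]min_r; last by lra.
      by rewrite min_r//; lra.
    rewrite clampK; [|lra..].
    rewrite ifF; last by apply/negbTE; rewrite -ltNge; lra.
    rewrite clampK; [|lra..].
    rewrite ifF; last by apply/negbTE; rewrite -ltNge; lra.
    by congr (r (clamp _)); lra.
Qed.

Lemma concat_reverse (x y : T) (p : {path I from x to y}) :
  homotopic (concat p (reverse p)) (cst_path x).
Proof.
exists (fun z => p (clamp ((1 - ival z.2) *
  Num.min (2 * ival z.1) (2 - 2 * ival z.1)))); split=> /=.
- by apply: (@continuous_compT _ _ _ _ p); cont.
- move=> t; have t0 := ival_ge0 t; have t1 := ival_le1 t.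
  rewrite ival0 subr0 mul1r /concat /= /reverse.
  have [t2|t2] := leP (ival t) 2^-1; first by rewrite min_l//; lra.
  rewrite min_r; last by lra.
  rewrite (@clampK _ (2 * ival t - 1)); [|lra..].
  by congr (p (clamp _)); lra.
- by move=> t; rewrite ival1 subrr mul0r clamp_le0// path_zero.
- by move=> s; rewrite ival0 mulr0 min_l ?mulr0 ?clamp_le0 ?path_zero//; lra.
- move=> s; rewrite ival1 min_r; last by lra.
  by rewrite mulr1 subrr mulr0 clamp_le0// path_zero.
Qed.

Lemma reverse_concat (x y : T) (p : {path I from x to y}) :
  homotopic (concat (reverse p) p) (cst_path y).
Proof.
have := concat_reverse (reverse p); congr homotopic.
apply/path_eqP => t; rewrite /= /concat; case: ifP => // _.
rewrite /= /reverse; congr (p _); apply: ival_inj.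
set u := clamp (2 * ival t - 1).
have u0 := ival_ge0 u; have u1 := ival_le1 u.
rewrite (@clampK _ (1 - ival u)); [|lra..].
by rewrite clampK; lra.
Qed.

End Paths.

Lemma homotopic_comp (R : realType) (S T : topologicalType)
    (f : continuousType S T) (x y : S) (p q : {path (unitI R) from x to y}) :
  homotopic p q ->
  homotopic (f \o p : {path (unitI R) from f x to f y})
            (f \o q : {path (unitI R) from f x to f y}).
Proof.
move=> [H [cH H0 H1 Hx Hy]]; exists (f \o H); split=> /=.
- exact: (continuous_compT cH (@cts_fun _ _ f)).
- by move=> t; rewrite H0.
- by move=> t; rewrite H1.
- by move=> s; rewrite Hx.
- by move=> s; rewrite Hy.
Qed.

Section FundamentalGroup.
Variables (R : realType) (T : topologicalType) (x : T).
Local Notation loop := {path (unitI R) from x to x}.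

Definition homotopicb (p q : loop) : bool := `[< homotopic p q >].

Lemma homotopicb_refl : reflexive homotopicb.
Proof. by move=> p; apply/asboolP; exact: homotopic_refl. Qed.

Lemma homotopicb_sym : symmetric homotopicb.
Proof.
by move=> p q; apply/idP/idP => /asboolP h; apply/asboolP;
   exact: homotopic_sym.
Qed.

Lemma homotopicb_trans : transitive homotopicb.
Proof.
move=> q p r /asboolP pq /asboolP qr; apply/asboolP.
exact: homotopic_trans pq qr.
Qed.

Canonical homotopy_equiv :=
  EquivRel homotopicb homotopicb_refl homotopicb_sym homotopicb_trans.

Definition pi1 : Type := {eq_quot homotopy_equiv}.

HB.instance Definition _ := Choice.on pi1.
HB.instance Definition _ := EqQuotient.on pi1.

Definition pi1_class (p : loop) : pi1 := \pi_pi1 p.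

Lemma pi1_classP (p q : loop) : pi1_class p = pi1_class q <-> homotopic p q.
Proof.
by split=> [/eqmodP/asboolP//|pq]; apply/eqmodP/asboolP.
Qed.

Lemma pi1_class_repr (a : pi1) : pi1_class (repr a) = a.
Proof. exact: reprK. Qed.

Lemma homotopic_repr (p : loop) : homotopic (repr (pi1_class p)) p.
Proof. by apply/pi1_classP; rewrite pi1_class_repr. Qed.

Definition pi1_one : pi1 := pi1_class (cst_path R x).
Definition pi1_inv (a : pi1) : pi1 := pi1_class (reverse (repr a)).
Definition pi1_mul (a b : pi1) : pi1 :=
  pi1_class (concat (repr a) (repr b)).

Lemma pi1_mulE (p q : loop) :
  pi1_mul (pi1_class p) (pi1_class q) = pi1_class (concat p q).
Proof.
by apply/pi1_classP; apply: homotopic_concat; exact: homotopic_repr.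
Qed.

Lemma pi1_invE (p : loop) : pi1_inv (pi1_class p) = pi1_class (reverse p).
Proof. by apply/pi1_classP; apply: homotopic_reverse; exact: homotopic_repr. Qed.

Lemma pi1_mulA : associative pi1_mul.
Proof.
move=> a b c; rewrite -[a]pi1_class_repr -[b]pi1_class_repr.
rewrite -[c]pi1_class_repr !pi1_mulE; apply/esym/pi1_classP.
exact: concat_assoc.
Qed.

Lemma pi1_mul1 : left_id pi1_one pi1_mul.
Proof.
move=> a; rewrite -[a]pi1_class_repr pi1_mulE; apply/pi1_classP.
exact: concat_cstp.
Qed.

Lemma pi1_mulr1 : right_id pi1_one pi1_mul.
Proof.
move=> a; rewrite -[a]pi1_class_repr pi1_mulE; apply/pi1_classP.
exact: concat_pcst.
Qed.

Lemma pi1_mulV : left_inverse pi1_one pi1_inv pi1_mul.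
Proof.
move=> a; rewrite -[a]pi1_class_repr pi1_invE pi1_mulE; apply/pi1_classP.
exact: reverse_concat.
Qed.

Lemma pi1_mulrV : right_inverse pi1_one pi1_inv pi1_mul.
Proof.
move=> a; rewrite -[a]pi1_class_repr pi1_invE pi1_mulE; apply/pi1_classP.
exact: concat_reverse.
Qed.

HB.instance Definition _ := isGroup.Build pi1
  pi1_mulA pi1_mul1 pi1_mulr1 pi1_mulV pi1_mulrV.

End FundamentalGroup.

Section InducedMorphism.
Variables (R : realType) (S T : topologicalType).
Variables (f : continuousType S T) (x : S).

Definition pi1_map (a : pi1 R x) : pi1 R (f x) := pi1_class (f \o repr a).

Lemma pi1_mapE (p : {path (unitI R) from x to x}) :
  pi1_map (pi1_class p) = pi1_class (f \o p).
Proof. by apply/pi1_classP/homotopic_comp; exact: homotopic_repr. Qed.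

Lemma pi1_mapM : {morph pi1_map : a b / (a * b)%g}.
Proof.
move=> a b; rewrite -[a]pi1_class_repr -[b]pi1_class_repr.
rewrite [(_ * _)%g in LHS]pi1_mulE !pi1_mapE [RHS]pi1_mulE.
congr pi1_class; apply/path_eqP => t.
by rewrite /= /concat; case: ifP.
Qed.

Lemma pi1_map1 : pi1_map 1%g = 1%g.
Proof. by rewrite [LHS]pi1_mapE; congr pi1_class; apply/path_eqP. Qed.

HB.instance Definition _ :=
  isMultiplicative.Build (pi1 R x) (pi1 R (f x)) pi1_map pi1_mapM.
HB.instance Definition _ :=
  Multiplicative_isUMagmaMorphism.Build (pi1 R x) (pi1 R (f x))
    pi1_map pi1_map1.

End InducedMorphism.

Section Contranormal.
Variable G : groupType.

Definition is_subgroup (L : set G) : Prop :=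
  [/\ L 1%g, forall a b, L a -> L b -> L (a * b)%g &
      forall a, L a -> L a^-1%g].

Definition normal_closure (L : set G) : set G :=
  smallest is_subgroup [set (a ^ g)%g | a in L & g in setT].

Definition contranormal (L : set G) : Prop := normal_closure L = setT.

End Contranormal.

Section LocalConditions.
Variables (R : realType) (T : topologicalType).

Definition path_connected (V : set T) : Prop :=
  forall x y, V x -> V y ->
  exists p : {path (unitI R) from x to y}, range p `<=` V.

Definition locally_path_connected : Prop :=
  forall (x : T) (U : set T), nbhs x U ->
  exists V : set T, [/\ open_nbhs x V, V `<=` U & path_connected V].

Definition semilocally_simply_connected : Prop :=
  forall x : T, exists2 U : set T, nbhs x U &
  forall p : {path (unitI R) from x to x},
    range p `<=` U -> homotopic p (cst_path R x).

End LocalConditions.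

(* Main.v *)
(* By path lifting, a covering E of a connected, locally path-connected space is
   trivial exactly when every loop at the base point lifts to loops from all
   points of the fibre.  A loop q of X has this property in f^*(E) iff f o q has
   it in E.  The classes of loops with this property in E form a normal subgroup
   of G, so if f^*(E) is trivial this subgroup contains the normal closure N of
   H, and it is all of G when H is contranormal.  Conversely, let G act by right
   translation on the subsets C of G with N C <= C, and let E be the associated
   covering.  By normality N acts trivially, hence f^*(E) is trivial; if E is
   trivial then G fixes the subset N, so N = G. *)

Require Import Defs.
From HB Require Import structures.
From mathcomp Require Import all_boot all_order all_algebra.
From mathcomp Require Import all_classical all_reals all_analysis.
From mathcomp Require Import homotopy ring lra.

Set Implicit Arguments.
Unset Strict Implicit.
Unset Printing Implicit Defensive.

Import Order.TTheory GRing.Theory Num.Theory.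
Import numFieldNormedType.Exports.
Local Open Scope classical_set_scope.
Local Open Scope ring_scope.

(** * Lifts along intervals *)

(** Real induction: the supremum [c] of the points that [P] reaches from [a] is itself reached, and
    the local hypothesis at [c] carries [P] beyond it unless [b] is already within range. It stands
    in for cutting [[a, b]] into small pieces by compactness. *)
Lemma interval_ind (R : realType) (P : R -> R -> Prop) (a b : R) : a <= b ->
  (forall x y z, a <= x -> x <= y -> y <= z -> z <= b ->
    P x y -> P y z -> P x z) ->
  (forall t, a <= t -> t <= b -> exists2 U, nbhs t U &
    forall x y, a <= x -> x <= t -> t <= y -> y <= b -> U x -> U y -> P x y) ->
  P a b.
Proof.
move=> ab Ptrans Ploc.
have loc t : a <= t -> t <= b -> exists2 e : R, 0 < e &
    forall x y, a <= x -> x <= t -> t <= y -> y <= b ->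
      t - e < x -> y < t + e -> P x y.
  move=> ta tb; have [U /nbhs_ballP[e /= e0 eU] PU] := Ploc t ta tb.
  exists e => // x y ax xt ty yb xe ye; apply: PU => //; apply: eU.
    by rewrite /ball /= ger0_norm ?subr_ge0//; lra.
  by rewrite /ball /= ler0_norm ?subr_le0//; lra.
pose S := [set t | [/\ a <= t, t <= b & P a t]].
have Sa : S a.
  split=> //; have [e e0] := loc _ (lexx a) ab.
  by apply=> //; lra.
have supS : has_sup S by split; [exists a|exists b => t []].
set c := sup S.
have ac : a <= c by apply: ub_le_sup => //; exists b => t [].
have cb : c <= b by apply: ge_sup; [exists a|move=> t []].
have [e e0 Pe] := loc c ac cb.
have [s [sa sb Ps] cs] := sup_adherent e0 supS.
have sc : s <= c by apply: ub_le_sup => //; exists b => t [].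
have Pc (y : R) : c <= y -> y <= b -> y < c + e -> P a y.
  move=> cy yb ye; have sy : s <= y := le_trans sc cy.
  by apply: Ptrans Ps _ => //; exact: Pe.
have [bc|cb'] := leP b (c + e / 2); first by apply: Pc => //; lra.
have Sce : S (c + e / 2).
  by split; [lra|lra|apply: Pc; lra].
suff : c + e / 2 <= c by lra.
by apply: ub_le_sup => //; exists b => t [].
Qed.

Lemma nbhs_itv (R : realType) (t : R) (A : set R) : nbhs t A ->
  exists2 V, nbhs t V &
    forall x y, V x -> V y -> forall u, x <= u -> u <= y -> A u.
Proof.
move=> /nbhs_ballP[e /= e0 eA].
exists (ball t e); first exact: nbhsx_ballx.
rewrite /ball /= => x y; rewrite !ltr_distlC => /andP[x1 x2] /andP[y1 y2] u xu uy.
by apply: eA; rewrite /ball /= ltr_distlC; apply/andP; split; lra.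
Qed.

Section Lifts.
Variables (R : realType) (E Y : topologicalType) (p : E -> Y).
Hypothesis covp : is_covering p.

(** [sigma] is total, but only its values on [U] matter. Openness of the image is what later makes
    the trivialization continuous. *)
Definition local_section (U : set Y) (sigma : Y -> E) : Prop :=
  [/\ forall z, U z -> p (sigma z) = z,
      forall z, U z -> {for z, continuous sigma} &
      open (sigma @` U)].

Lemma continuous_covering : continuous p.
Proof. by case: covp. Qed.

(** The sheets through the two points over one evenly covered set are equal or disjoint, and [p] is
    injective on each. Hence agreement of two lifts is an open and closed condition, with no
    separation axiom on [E]. *)
Lemma covering_separated (e1 e2 : E) : p e1 = p e2 ->
  exists V1 V2, [/\ nbhs e1 V1, nbhs e2 V2 &
    forall u v, V1 u -> V2 v -> p u = p v -> (u = v <-> e1 = e2)].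
Proof.
move=> e12; have [cp /(_ (p e1))[U [oU Uy] [F [Fo Ft FU Fh]]]] := covp.
have sheet e : p e = p e1 -> exists2 V, F V & V e.
  by move=> pe; have : (\bigcup_(V in F) V) e by rewrite FU /= pe.
have inj V u v : F V -> V u -> V v -> p u = p v -> u = v.
  move=> FV Vu Vv uv; have [h [_ [g [_ hg _]]] hp] := Fh _ FV.
  have : h (set_in (mem_set Vu)) = h (set_in (mem_set Vv)).
    by apply: val_inj; rewrite [LHS]hp [RHS]hp.
  by move/(can_inj hg)/(congr1 set_val).
have [V1 F1 Ve1] := sheet e1 erefl; have [V2 F2 Ve2] := sheet e2 (esym e12).
exists V1, V2; split.
- by apply: open_nbhs_nbhs; split=> //; exact: Fo.
- by apply: open_nbhs_nbhs; split=> //; exact: Fo.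
- move=> u v V1u V2v uv; split=> [uv'|e1e2].
  + apply: (inj V1) => //; rewrite (Ft V1 V2)//.
    by exists u; split=> //; rewrite uv'.
  + apply: (inj V1) => //; rewrite (Ft V1 V2)//.
    by exists e1; split=> //; rewrite e1e2.
Qed.

Lemma covering_section (y : Y) : exists2 U, open_nbhs y U &
  forall e, U (p e) -> exists2 sigma, local_section U sigma & sigma (p e) = e.
Proof.
have [cp /(_ y)[U [oU Uy] [F [Fo Ft FU Fh]]]] := covp.
exists U => // e Ue.
have [V FV Ve] : (\bigcup_(V in F) V) e by rewrite FU.
have [h [ch [g [cg hg gh]]] hp] := Fh _ FV.
(* Off [U] the value is irrelevant; [e] is merely a point known to exist. *)
pose sigma (z : Y) : E :=
  if pselect (U z) is left Uz then set_val (g (set_in (mem_set Uz))) else e.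
have sE z (Uz : U z) : sigma z = set_val (g (set_in (mem_set Uz))).
  by rewrite /sigma; case: pselect => // Uz'; congr (set_val (g _)); exact: val_inj.
have ps z : U z -> p (sigma z) = z by move=> Uz; rewrite sE -hp gh.
have sp v : V v -> sigma (p v) = v.
  move=> Vv; have Up : U (p v).
    have : (\bigcup_(V in F) V) v by exists V.
    by rewrite FU.
  rewrite sE (_ : set_in _ = h (set_in (mem_set Vv))) ?hg//.
  by apply: val_inj; rewrite /= [RHS]hp.
exists sigma; last exact: sp.
split=> //.
- move=> z Uz.
  have sU : {within U, continuous sigma}.
    apply/subspace_sigL_continuousP.
    rewrite (_ : sigL U sigma = set_val \o g); last first.
      apply/funext => u; rewrite /sigL /= (sE _ (set_valP u)).
      by congr (set_val (g _)); exact: val_inj.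
    by apply: continuous_compT cg _; exact: continuous_set_val.
  have := sU; rewrite continuous_open_subspace// => /(_ z).
  by apply; rewrite inE.
- rewrite (_ : _ @` _ = V); first exact: Fo.
  rewrite predeqE => v; split=> [[z Uz <-]|Vv].
    by rewrite sE; exact: (set_valP (g _)).
  exists (p v); last exact: sp.
  have : (\bigcup_(V in F) V) v by exists V.
  by rewrite FU.
Qed.

(** [h] is continuous on the whole line although it lifts [g] only over [[a, b]], so that pieces are
    pasted without subspaces. *)
Definition lift (g : R -> Y) (a b : R) (e e' : E) : Prop :=
  exists h : R -> E, [/\ continuous h,
    forall t, a <= t -> t <= b -> p (h t) = g t, h a = e & h b = e'].

Lemma lift_concat (g : R -> Y) (a b c : R) (e1 e2 e3 : E) :
  a <= b -> b <= c -> lift g a b e1 e2 -> lift g b c e2 e3 -> lift g a c e1 e3.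
Proof.
move=> ab bc [h [ch ph ha hb]] [k [ck pk kb kc]].
exists (fun t => if t <= b then h t else k t); split.
- apply: continuous_paste => //; first by move=> ?; exact: cvg_id.
  by move=> t ->; rewrite hb kb.
- move=> t ta tc; case: (leP t b) => tb; first exact: ph.
  by apply: pk => //; exact: ltW.
- by rewrite ab.
- case: (leP c b) => // cb; have cbE : c = b by apply/le_anti/andP.
  by rewrite cbE hb -kb -kc cbE.
Qed.

Lemma lift_split (g : R -> Y) (a b c : R) (e1 e3 : E) :
  a <= b -> b <= c -> lift g a c e1 e3 ->
  exists2 e2, lift g a b e1 e2 & lift g b c e2 e3.
Proof.
move=> ab bc [h [ch ph ha hb]]; exists (h b); exists h; split=> // t ta tb.
  by apply: ph => //; exact: le_trans bc.
by apply: ph => //; exact: le_trans ta.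
Qed.

Lemma lift_section (g : R -> Y) (a b : R) (U : set Y) (sigma : Y -> E) :
  continuous g -> local_section U sigma -> a <= b ->
  (forall t, a <= t -> t <= b -> U (g t)) ->
  lift g a b (sigma (g a)) (sigma (g b)).
Proof.
move=> cg [ps cs _] ab gU.
(* Retracting the line onto [[a, b]] keeps [g (cl t)] in [U], where [sigma] is continuous. *)
pose cl t := Num.max a (Num.min b t).
have clE t : a <= t -> t <= b -> cl t = t.
  by move=> ta tb; rewrite /cl min_r// max_r.
have Ucl t : U (g (cl t)).
  by apply: gU; rewrite /cl ?le_max ?lexx// ge_max ab ge_min lexx.
exists (fun t => sigma (g (cl t))); split.
- move=> t; apply: (@continuous_comp _ _ _ (fun t => g (cl t)) sigma).
    apply: (@continuous_compT _ _ _ cl g _ cg).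
    apply: (@continuous_maxR _ _ (fun=> a)); first exact: continuous_cstR.
    apply: (@continuous_minR _ _ (fun=> b) id); first exact: continuous_cstR.
    by move=> ?; exact: cvg_id.
  exact: cs.
- by move=> t ta tb; rewrite clE// ps//; exact: gU.
- by rewrite clE.
- by rewrite clE.
Qed.

(** Interval induction on the implication from agreement at [x] to agreement at [y]; near [t] each
    is equivalent to agreement at [t]. *)
Lemma lift_unique (g : R -> Y) (a b : R) (e e1 e2 : E) :
  a <= b -> lift g a b e e1 -> lift g a b e e2 -> e1 = e2.
Proof.
move=> ab [h [ch ph ha hb]] [k [ck pk ka kb]].
suff : h a = k a -> h b = k b by rewrite ha hb ka kb => /(_ erefl).
apply: (@interval_ind R (fun x y => h x = k x -> h y = k y)) => //.
  by move=> x y z _ _ _ _ xy yz /xy/yz.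
move=> t ta tb.
have [V1 [V2 [V1h V2k V12]]] :=
  covering_separated (etrans (ph t ta tb) (esym (pk t ta tb))).
exists (h @^-1` V1 `&` k @^-1` V2); first by apply: filterI; [exact: ch|exact: ck].
move=> x y ax xt ty yb [V1x V2x] [V1y V2y].
have hk u : a <= u -> u <= b -> p (h u) = p (k u) by move=> au ub; rewrite ph// pk.
move=> /(V12 _ _ V1x V2x (hk _ _ _)) hkt; apply/(V12 _ _ V1y V2y (hk _ _ _)) => //.
- exact: le_trans ty.
- by apply: hkt => //; exact: le_trans tb.
Qed.

Lemma lift_exists (g : R -> Y) (a b : R) (e : E) :
  continuous g -> a <= b -> p e = g a -> exists e', lift g a b e e'.
Proof.
move=> cg ab; move: e.
(* The property covers every starting point, so that lifts over adjacent intervals can be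
   chained. *)
apply: (@interval_ind R (fun x y =>
  forall e, p e = g x -> exists e', lift g x y e e')) => //.
  move=> x y z _ xy yz _ Px Py e ex; have [e' ee'] := Px e ex.
  have [h [_ ph _ hy]] := ee'.
  have [|e'' ee''] := Py e'; first by rewrite -hy ph.
  by exists e''; exact: lift_concat ee' ee''.
move=> t _ _; have [U oU Us] := covering_section (g t).
have [V Vt VU] := nbhs_itv (cg _ _ (open_nbhs_nbhs oU)).
exists V => // x y _ xt ty _ Vx Vy e ex.
have xy := le_trans xt ty.
have [|s ss se] := Us e; first by rewrite ex; apply: VU Vx Vy _ _ _.
exists (s (g y)); rewrite -[X in lift _ _ _ X]se ex.
by apply: (lift_section cg ss xy); exact: VU Vx Vy.
Qed.
End Lifts.

(** * Homotopy invariance of lifts *)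

Section Squares.
Variables (R : realType) (E Y : topologicalType) (p : E -> Y).
Hypothesis covp : is_covering p.
Variable H : R -> R -> Y.
Hypothesis cH : continuous (fun z : R * R => H z.1 z.2).

Let cH1 (s : R) : continuous (H^~ s).
Proof.
apply: (@continuous_compT _ _ _ (fun t => (t, s)) _ _ cH).
by apply: continuous_pair; [move=> ?; exact: cvg_id|exact: continuous_cstR].
Qed.

Let cH2 (t : R) : continuous (H t).
Proof.
apply: (@continuous_compT _ _ _ (fun s => (t, s)) _ _ cH).
by apply: continuous_pair; [exact: continuous_cstR|move=> ?; exact: cvg_id].
Qed.

(** Trivial monodromy around the rectangle [[a, b] x [c, d]]: bottom then right edge against left
    then top edge. *)
Definition square_commutes (a b c d : R) : Prop :=
  forall e0 e1 e2 e3 e3',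
    lift p (H^~ c) a b e0 e1 -> lift p (H b) c d e1 e3 ->
    lift p (H a) c d e0 e2 -> lift p (H^~ d) a b e2 e3' -> e3 = e3'.

Lemma lift_proj (g : R -> Y) (a b : R) (e e' : E) :
  a <= b -> lift p g a b e e' -> p e = g a /\ p e' = g b.
Proof. by move=> ab [h [_ ph <- <-]]; rewrite !ph. Qed.

Lemma square_concat1 (a b m c d : R) : a <= m -> m <= b -> c <= d ->
  square_commutes a m c d -> square_commutes m b c d -> square_commutes a b c d.
Proof.
move=> am mb cd s1 s2 e0 e1 e2 e3 e3' /(lift_split am mb)[f1 l1 l2] r l.
move=> /(lift_split am mb)[f2 u1 u2].
have [_ pf1] := lift_proj am l1.
have [f2' v] := lift_exists covp (cH2 (t := m)) cd pf1.
have ff : f2' = f2 := s1 _ _ _ _ _ l1 v l u1.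
by rewrite ff in v; exact: s2 l2 r v u2.
Qed.

Lemma square_concat2 (a b c m d : R) : c <= m -> m <= d -> a <= b ->
  square_commutes a b c m -> square_commutes a b m d -> square_commutes a b c d.
Proof.
move=> cm md ab s1 s2 e0 e1 e2 e3 e3' l /(lift_split cm md)[f1 r1 r2].
move=> /(lift_split cm md)[f2 l1 l2] u.
have [_ pf2] := lift_proj cm l1.
have [f1' v] := lift_exists covp (cH1 (s := m)) ab pf2.
have ff : f1 = f1' := s1 _ _ _ _ _ l r1 l1 v.
by rewrite -ff in v; exact: s2 v r2 l2 u.
Qed.

(** A small rectangle is mapped into a set [U] with a section through [e0]; by uniqueness all four
    lifted edges are that section composed with [H]. *)
Lemma square_local (t s : R) : exists A B, [/\ nbhs t A, nbhs s B &
  forall a b c d, A a -> A b -> B c -> B d -> a <= b -> c <= d ->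
    square_commutes a b c d].
Proof.
have [U oU Us] := covering_section covp (H t s).
have := @cH (t, s) U (open_nbhs_nbhs oU) => -[[A0 B0] /= [A0t B0s] AB].
have [A At AA] := nbhs_itv A0t; have [B Bs BB] := nbhs_itv B0s.
exists A, B; split=> // a b c d Aa Ab Bc Bd ab cd e0 e1 e2 e3 e3' l0 r l u.
have HU x y : a <= x -> x <= b -> c <= y -> y <= d -> U (H x y).
  move=> ax xb cy yd; apply: (AB (x, y)); split => /=.
    exact: AA Aa Ab _ _ _.
  exact: BB Bc Bd _ _ _.
have [pe0 _] := lift_proj ab l0.
have [|sg ss se] := Us e0; first by rewrite pe0; exact: HU.
have e0E : e0 = sg (H a c) by rewrite -pe0.
have l1 : e1 = sg (H b c).
  apply: (lift_unique covp ab l0); rewrite e0E.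
  by apply: (lift_section (cH1 (s := c)) ss) => // x ax xb; exact: HU.
have l2 : e2 = sg (H a d).
  apply: (lift_unique covp cd l); rewrite e0E.
  by apply: (lift_section (cH2 (t := a)) ss) => // x ax xb; exact: HU.
have l3 : e3 = sg (H b d).
  apply: (lift_unique covp cd r); rewrite l1.
  by apply: (lift_section (cH2 (t := b)) ss) => // x ax xb; exact: HU.
rewrite l3; apply: (lift_unique covp ab _ u); rewrite l2.
by apply: (lift_section (cH1 (s := d)) ss) => // x ax xb; exact: HU.
Qed.

(* Two nested interval inductions replace the usual Lebesgue number argument. *)
Lemma squareP (a b c d : R) : a <= b -> c <= d -> square_commutes a b c d.
Proof.
move=> ab cd; apply: (@interval_ind R (square_commutes a b)) => //.
  by move=> x y z _ xy yz _; exact: square_concat2.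
move=> s _ _.
suff [V Vs Vsq] : exists2 V, nbhs s V & forall x y, x <= s -> s <= y ->
    V x -> V y -> square_commutes a b x y.
  by exists V => // x y _ xs sy _; exact: Vsq.
apply: (@interval_ind R (fun a b => exists2 V, nbhs s V &
    forall x y, x <= s -> s <= y -> V x -> V y -> square_commutes a b x y)) => //.
  move=> x y z _ xy yz _ [V Vs Vsq] [W Ws Wsq].
  exists (V `&` W); first exact: filterI.
  move=> c' d' cs sd [Vc Wc] [Vd Wd].
  by apply: (square_concat1 xy yz (le_trans cs sd)); [exact: Vsq|exact: Wsq].
move=> t _ _; have [A [B [At Bs AB]]] := square_local t s.
exists A => // x y _ xt ty _ Ax Ay; exists B => // c' d' cs sd Bc Bd.
by apply: AB => //; [exact: le_trans ty|exact: le_trans sd].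
Qed.

End Squares.

(** * Path lifting over the unit interval *)

Section PathLifts.
Variables (R : realType) (E Y : topologicalType) (p : E -> Y).
Hypothesis covp : is_covering p.
Local Notation I := (unitI R).

Definition path_lift (y z : Y) (q : {path I from y to z}) (e e' : E) : Prop :=
  exists h : {path I from e to e'}, forall t, p (h t) = q t.

Lemma path_lift_proj (y z : Y) (q : {path I from y to z}) (e e' : E) :
  path_lift q e e' -> p e = y /\ p e' = z.
Proof.
move=> [h hq]; have /= := hq zero; have /= := hq one.
by rewrite !path_zero !path_one.
Qed.

Lemma path_liftP (y z : Y) (q : {path I from y to z}) (e e' : E) :
  path_lift q e e' <-> lift p (q \o @clamp R) 0 1 e e'.
Proof.
split=> [[h hq]|[h [ch ph h0 h1]]].
  exists (h \o @clamp R); split=> //=.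
  - by apply: continuous_compT; [exact: clamp_continuous|exact: cts_fun].
  - by rewrite clamp_le0// path_zero.
  - by rewrite clamp_ge1// path_one.
have c : continuous (fun t : I => h (ival t)).
  exact: continuous_compT (@ival_continuous R) ch.
exists (mk_path c h0 h1) => t; rewrite /mk_path /=.
by rewrite ph ?ival_ge0 ?ival_le1//= ivalK.
Qed.

Lemma path_lift_exists (y z : Y) (q : {path I from y to z}) (e : E) :
  p e = y -> exists e', path_lift q e e'.
Proof.
move=> ey; have [||e' l] := @lift_exists _ _ _ _ covp (q \o @clamp R) 0 1 e _ ler01.
- by apply: continuous_compT; [exact: clamp_continuous|exact: cts_fun].
- by rewrite /= clamp_le0// path_zero.
- by exists e'; apply/path_liftP.
Qed.

(** Extended to a map of the plane, the homotopy is constant on the two vertical edges of the unit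
    square; these lift to constants, and the commuting square compares the other two edges. *)
Lemma path_lift_homotopic (y z : Y) (q q' : {path I from y to z}) (e e1 e2 : E) :
  homotopic q q' -> path_lift q e e1 -> path_lift q' e e2 -> e1 = e2.
Proof.
move=> [H [cH H0 H1 Hy Hz]] l1 l2.
pose K (t s : R) := H (clamp t, clamp s).
have cK : continuous (fun z : R * R => K z.1 z.2).
  by apply: continuous_compT cH; cont.
have [p0 p1] := path_lift_proj l1.
have K0 : K^~ 0 = q \o @clamp R.
  by apply/funext => t; rewrite /K (@clamp_le0 _ 0)// H0.
have K1 : K^~ 1 = q' \o @clamp R.
  by apply/funext => t; rewrite /K (@clamp_ge1 _ 1)// H1.
apply: (squareP covp cK (@ler01 R) (@ler01 R) (e0 := e) (e1 := e1) (e2 := e)).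
- by rewrite K0; apply/path_liftP.
- exists (cst e1); split=> // [|t t0 t1]; first exact: cst_continuous.
  by rewrite /K (@clamp_ge1 _ 1)// Hz p1.
- exists (cst e); split=> // [|t t0 t1]; first exact: cst_continuous.
  by rewrite /K (@clamp_le0 _ 0)// Hy p0.
- by rewrite K1; apply/path_liftP.
Qed.

Lemma path_lift_unique (y z : Y) (q : {path I from y to z}) (e e1 e2 : E) :
  path_lift q e e1 -> path_lift q e e2 -> e1 = e2.
Proof. by apply: path_lift_homotopic; exact: homotopic_refl. Qed.

Lemma path_lift_concat (x y z : Y) (q : {path I from x to y})
    (r : {path I from y to z}) (e1 e2 e3 : E) :
  path_lift q e1 e2 -> path_lift r e2 e3 -> path_lift (concat q r) e1 e3.
Proof.
move=> [h hq] [k kr]; exists (concat h k) => t.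
by rewrite /= /concat; case: ifP.
Qed.

Lemma path_lift_reverse (y z : Y) (q : {path I from y to z}) (e e' : E) :
  path_lift q e e' -> path_lift (reverse q) e' e.
Proof. by move=> [h hq]; exists (reverse h) => t; rewrite /= /reverse. Qed.

Lemma path_lift_section (y z : Y) (q : {path I from y to z}) (U : set Y)
    (sigma : Y -> E) :
  local_section p U sigma -> range q `<=` U ->
  path_lift q (sigma y) (sigma z).
Proof.
move=> ss qU; apply/path_liftP.
have -> : sigma y = sigma ((q \o @clamp R) 0) by rewrite /= clamp_le0// path_zero.
have -> : sigma z = sigma ((q \o @clamp R) 1) by rewrite /= clamp_ge1// path_one.
apply: (lift_section _ ss) => //.
- by apply: continuous_compT; [exact: clamp_continuous|exact: cts_fun].
- by move=> t _ _; apply: qU; exists (clamp t).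
Qed.

End PathLifts.

(** * Coverings with trivial monodromy *)

Lemma reverseK (R : realType) (T : topologicalType) (x y : T)
    (q : {path (unitI R) from x to y}) :
  (reverse (reverse q) : {path (unitI R) from x to y}) = q.
Proof.
apply/path_eqP => t; rewrite /= /reverse /= /reverse; congr (q _).
have t0 := ival_ge0 t; have t1 := ival_le1 t; apply: ival_inj.
by rewrite (@clampK _ (1 - ival t)) ?clampK; lra.
Qed.

(** The path component of [x] is open and closed, since a path-connected neighbourhood lies wholly
    inside or outside it. *)
Lemma connected_paths (R : realType) (T : topologicalType) (x : T) :
  connected [set: T] -> locally_path_connected R T ->
  forall y, inhabited {path (unitI R) from x to y}.
Proof.
move=> cT lT.
pose B := [set y | inhabited {path (unitI R) from x to y}].
suff : B = setT by move=> + y => /seteqP[_]; apply.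
apply: cT.
- by exists x; exact: (inhabits (cst_path R x : {path (unitI R) from x to x})).
- exists B; last by rewrite setTI.
  rewrite openE => y [q]; have [V [oV _ cV]] := lT y setT (@filterT _ _ _).
  apply: filterS (open_nbhs_nbhs oV) => z Vz.
  have [r _] := cV y z (oV.2) Vz.
  exact: (inhabits (concat q r : {path (unitI R) from x to _})).
- exists B; last by rewrite setTI.
  rewrite -[B]setCK; apply: open_closedC; rewrite openE => y nBy.
  have [V [oV _ cV]] := lT y setT (@filterT _ _ _).
  apply: filterS (open_nbhs_nbhs oV) => z Vz [q]; apply: nBy.
  have [r _] := cV z y Vz (oV.2).
  exact: (inhabits (concat q r : {path (unitI R) from x to _})).
Qed.

(** The monodromy of [q] fixes the fibre over [y] pointwise. *)
Definition closes_up (R : realType) (E Y : topologicalType) (p : E -> Y)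
    (y : Y) (q : {path (unitI R) from y to y}) : Prop :=
  forall e, p e = y -> path_lift p q e e.

Section Trivialization.
Variables (R : realType) (Z : topologicalType) (E : cov Z) (z0 : Z).
Hypothesis lZ : locally_path_connected R Z.
Local Notation I := (unitI R).
Local Notation p := (@cov_proj Z E).
Variable c : forall z, {path I from z0 to z}.
Hypothesis closed_loops : forall q : {path I from z0 to z0}, closes_up p q.

Let covE := cov_projP E.
Local Notation fiber := (set_type [set e : E | p e = z0]).

Let fiberP (a : fiber) : p (set_val a) = z0.
Proof. exact: (set_valP a). Qed.

Definition transport (a : fiber) (z : Z) : E :=
  sval (cid (path_lift_exists covE (c z) (fiberP a))).

Lemma transportP a z : path_lift p (c z) (set_val a) (transport a z).
Proof. exact: (svalP (cid (path_lift_exists covE (c z) (fiberP a)))). Qed.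

Lemma transport_proj a z : p (transport a z) = z.
Proof. by have [] := path_lift_proj (transportP a z). Qed.

(** [q] followed by [reverse (c z)] is a loop at [z0], so it lifts to a loop; hence the end of a
    lift does not depend on the path taken. *)
Lemma transport_unique a z (q : {path I from z0 to z}) e :
  path_lift p q (set_val a) e -> e = transport a z.
Proof.
move=> qe; have [_ ez] := path_lift_proj qe.
have [e' re'] := path_lift_exists covE (reverse (c z)) ez.
have e'a : e' = set_val a.
  apply: (path_lift_unique covE (path_lift_concat qe re')).
  exact/closed_loops/fiberP.
have := path_lift_reverse re'; rewrite reverseK e'a => ae.
exact: (path_lift_unique covE ae (transportP a z)).
Qed.

Lemma transport_inj a b z : transport a z = transport b z -> a = b.
Proof.
move=> ab; apply: val_inj.
apply: (path_lift_unique covE (path_lift_reverse (transportP a z))).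
by rewrite ab; exact: path_lift_reverse (transportP b z).
Qed.

Lemma transport_surj e : exists a, transport a (p e) = e.
Proof.
have [e' re'] := path_lift_exists covE (reverse (c (p e))) (erefl (p e)).
have [_ pe'] := path_lift_proj re'.
exists (set_in (mem_set (pe' : [set e : E | p e = z0] e'))).
apply/esym/(transport_unique (q := c (p e))).
by rewrite -[c _]reverseK; exact: path_lift_reverse.
Qed.

(** In place of [c w] one may take [c z] followed by a path inside [V], whose lift follows the
    section. Local path-connectedness enters here. *)
Lemma transport_section (a : fiber) (z : Z) : exists U sigma V,
  [/\ local_section p U sigma, nbhs z V, V `<=` U &
      forall w, V w -> transport a w = sigma w].
Proof.
have [U oU Us] := covering_section covE z.
have [|sigma ss sz] := Us (transport a z).
  by rewrite transport_proj; exact: nbhs_singleton (open_nbhs_nbhs oU).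
have [V [oV VU cV]] := lZ (open_nbhs_nbhs oU).
exists U, sigma, V; split=> //; first exact: open_nbhs_nbhs.
move=> w Vw; have [q qV] := cV z w oV.2 Vw.
apply/esym/(transport_unique (q := concat (c z) q)).
apply: path_lift_concat (transportP a z) _.
rewrite -sz transport_proj.
exact: path_lift_section ss (subset_trans qV VU).
Qed.

Lemma transport_continuous a : continuous (transport a).
Proof.
move=> z W Wz; have [U [sigma [V [[_ cs _] Vz VU tE]]]] := transport_section a z.
have Vz' : V z := nbhs_singleton Vz.
have : nbhs z (sigma @^-1` W) by apply: cs; [exact: VU|rewrite -tE].
by apply: filterS2 Vz => w Vw; rewrite /= tE.
Qed.

Let idx (e : E) : fiber := sval (cid (transport_surj e)).

Let idxP e : transport (idx e) (p e) = e.
Proof. exact: (svalP (cid (transport_surj e))). Qed.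

Let triv (e : E) : cov_copies Z fiber := existT _ (idx e) (p e).

(** The section through [e] has open image, and over [V] it agrees with the transport of [idx e]; so
    [idx] is constant near [e]. *)
Let triv_continuous : continuous triv.
Proof.
move=> e W We.
have [U [sigma [V [[ps _ os] Vz VU tE]]]] := transport_section (idx e) (p e).
have Vpe : V (p e) := nbhs_singleton Vz.
have se : sigma (p e) = e by rewrite -tE// idxP.
have cp : continuous p := continuous_covering covE.
have sU : nbhs e (sigma @` U).
  by apply: open_nbhs_nbhs; split=> //; exists (p e) => //; exact: VU.
have Wn : nbhs e (p @^-1` [set z | W (existT _ (idx e) z)]) by exact: cp.
have Vn : nbhs e (p @^-1` V) by exact: cp.
change (nbhs e (triv @^-1` W)).
apply: filterS (filterI sU (filterI Wn Vn)) => e' [[w Uw we'] [We' Ve']].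
have pe' : p e' = w by rewrite -we' ps.
suff te' : triv e' = existT _ (idx e) (p e') by rewrite /= te'.
rewrite /triv; congr existT; apply: (@transport_inj _ _ (p e')).
by rewrite idxP tE// pe'.
Qed.

Lemma trivial_of_closed_loops : trivial_cov E.
Proof.
exists fiber.
have trivP e : p e = cov_proj (triv e) by [].
pose s (x : cov_copies Z fiber) : E := transport (projT1 x) (projT2 x).
have cs : continuous s by move=> [a z] W Wz; exact: (@transport_continuous a z W Wz).
have sP x : cov_proj x = p (s x) by case: x => a z; rewrite [RHS]transport_proj.
exists (CovMor triv_continuous trivP), (CovMor cs sP); split.
- by move=> e; exact: idxP.
- move=> [a z]; rewrite /= /triv /s /= transport_proj; congr existT.
  apply: (@transport_inj _ _ z).
  by rewrite -[X in transport _ X](transport_proj a z) idxP.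
Qed.

End Trivialization.

(** * Trivial monodromy as a normal subgroup *)

Section ClosingLoops.
Variables (R : realType) (E Y : topologicalType) (p : E -> Y).
Hypothesis covp : is_covering p.
Variable y : Y.
Local Notation I := (unitI R).
Implicit Types q r : {path I from y to y}.

Lemma closes_up_homotopic q r :
  homotopic q r -> closes_up p q -> closes_up p r.
Proof.
move=> qr cq e ey; have [e' re'] := path_lift_exists covp r ey.
by have eE := path_lift_homotopic covp qr (cq e ey) re'; rewrite -eE in re'.
Qed.

(** The kernel of the monodromy action of the fundamental group on the fibre over [y]. *)
Definition closing_classes : set (pi1 R y) := [set a | closes_up p (repr a)].

Lemma closing_classE q : closing_classes (pi1_class q) <-> closes_up p q.
Proof.
split; apply: closes_up_homotopic; first exact: homotopic_repr.
exact/homotopic_sym/homotopic_repr.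
Qed.

Lemma closing_classes_subgroup : is_subgroup closing_classes.
Proof.
split.
- apply/closing_classE => e ey; exists (cst_path R e) => t.
  by rewrite /= ey.
- move=> a b ca cb; apply/closing_classE => e ey.
  exact: (path_lift_concat (ca e ey) (cb e ey)).
- move=> a ca; apply/closing_classE => e ey.
  exact: (path_lift_reverse (ca e ey)).
Qed.

(** From [e] go back along [g] to some [e']; there [a] closes up, and going forward along [g]
    returns to [e]. *)
Lemma closing_classesJ a g : closing_classes a -> closing_classes (a ^ g)%g.
Proof.
move=> ca; rewrite /conjg -[g]pi1_class_repr -[a]pi1_class_repr.
rewrite [(_^-1)%g]pi1_invE [X in (_ * X)%g]pi1_mulE [(_ * _)%g]pi1_mulE.
apply/closing_classE => e ey.
have [e' ge'] := path_lift_exists covp (reverse (repr g)) ey.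
have [_ ey'] := path_lift_proj ge'.
apply: (path_lift_concat ge' (path_lift_concat (ca e' ey') _)).
by rewrite -[repr g]reverseK; exact: path_lift_reverse.
Qed.

End ClosingLoops.

(** In a union of copies of [Y] the loop lifts within a single copy, the one containing [t e]; [s]
    carries this lift to [E]. *)
Lemma trivial_closes_up (R : realType) (Y : topologicalType) (E : cov Y) (y : Y)
    (q : {path (unitI R) from y to y}) :
  trivial_cov E -> closes_up (@cov_proj Y E) q.
Proof.
move=> [C [t [s [st ts]]]] e ey; have := cov_mapP t e.
case te : (t e) => [i z]; rewrite [RHS]/= /copies_proj /= ey => yz.
pose h (u : unitI R) : E := s (existT _ i (q u)).
have ch : continuous h.
  apply: (@continuous_compT _ _ _ q (fun z => s (existT _ i z))).
    exact: cts_fun.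
  exact: (continuous_compT (@existT_continuous _ _ i) (@cov_map_continuous _ _ _ s)).
have h0 : h zero = e by rewrite /h path_zero yz -te; exact: st.
have h1 : h one = e by rewrite /h path_one yz -te; exact: st.
exists (mk_path ch h0 h1) => u; rewrite /mk_path /= /h.
by rewrite -cov_mapP.
Qed.

Section PullbackLoops.
Variables (R : realType) (X Y : topologicalType) (f : continuousType X Y).
Variables (E : cov Y) (x : X) (q : {path (unitI R) from x to x}).
Local Notation fq := (f \o q : {path (unitI R) from f x to f x}).

(** Lifts of [q] to the pullback are the pairs [(q u, h u)] with [h] a lift of [f \o q], and the
    fibre over [x] is the fibre of [E] over [f x]. *)
Lemma pullback_closes_up :
  closes_up (@cov_proj X (pullback_cov f E)) q <-> closes_up (@cov_proj Y E) fq.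
Proof.
split=> [cq e ex|cq z zx].
- have inP : (x, e) \in [set xe : X * E | f xe.1 = cov_proj xe.2].
    by rewrite inE /= ex.
  have [h hq] := cq (set_in inP : pullback_cov f E) erefl.
  pose k u := (set_val (h u)).2.
  have ck : continuous k.
    apply: (@continuous_compT _ _ _ h (fun z => (set_val z).2)).
      exact: cts_fun.
    exact: pullback_snd_continuous.
  have k0 : k zero = e by rewrite /k path_zero.
  have k1 : k one = e by rewrite /k path_one.
  exists (mk_path ck k0 k1) => u; rewrite /mk_path /= /k -hq.
  exact/esym/(set_valP (h u)).
- have fz : f x = cov_proj (set_val z).2.
    by rewrite -zx; exact: (set_valP z).
  have [h hq] := cq _ (esym fz).
  have inP u : (q u, h u) \in [set xe : X * E | f xe.1 = cov_proj xe.2].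
    by rewrite inE /= hq.
  pose k u : pullback_cov f E := set_in (inP u).
  have ck : continuous k.
    by apply: continuous_set_type; apply: continuous_pair; exact: cts_fun.
  have zE u : q u = x -> h u = (set_val z).2 -> k u = z.
    move=> qu hu; apply: val_inj; rewrite /= qu hu -zx.
    by rewrite [RHS]surjective_pairing.
  have k0 : k zero = z by apply: zE; rewrite path_zero.
  have k1 : k one = z by apply: zE; rewrite path_one.
  by exists (mk_path ck k0 k1).
Qed.

End PullbackLoops.

(** * Normal closures *)

Section NormalClosure.
Variables (G : groupType) (L : set G).

Lemma normal_closure_subgroup : is_subgroup (normal_closure L).
Proof.
split.
- by move=> K [[K1 _ _] _].
- by move=> a b ca cb K KL; have [[_ KM _] _] := KL; apply: KM; [exact: ca|exact: cb].
- by move=> a ca K KL; have [[_ _ KV] _] := KL; apply: KV; exact: ca.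
Qed.

Lemma sub_normal_closure : L `<=` normal_closure L.
Proof. by move=> a La K [_]; apply; exists a => //; exists 1%g; rewrite ?conjg1. Qed.

Lemma normal_closureJ a g : normal_closure L a -> normal_closure L (a ^ g)%g.
Proof.
move=> ca K [[K1 KM KV] LK].
(* Minimality is used for the preimage of [K] under conjugation by [g]; it contains the generators
   because [(b ^ h) ^ g = b ^ (h * g)]. *)
apply: (ca [set b | K (b ^ g)%g]); split; first split.
- by rewrite /= conj1g.
- by move=> b c; rewrite /= conjMg; exact: KM.
- by move=> b; rewrite /= conjVg; exact: KV.
- move=> _ [b Lb [h _ <-]]; rewrite /= -conjgM; apply: LK.
  by exists b => //; exists (h * g)%g.
Qed.

End NormalClosure.

Lemma contranormal_nullity_zero (R : realType) (X Y : topologicalType)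
    (f : continuousType X Y) (x0 : X) :
  connected [set: Y] -> locally_path_connected R Y ->
  contranormal (range (@pi1_map R X Y f x0)) -> nullity_zero f.
Proof.
move=> cY lY cn E tE.
pose c y := inhabited_witness (connected_paths (f x0) cY lY y).
apply: (trivial_of_closed_loops lY c) => q.
apply/closing_classE; first exact: cov_projP.
have : normal_closure (range (@pi1_map R X Y f x0)) (pi1_class q) by rewrite cn.
apply; split; first exact/closing_classes_subgroup/cov_projP.
move=> _ [_ [a _ <-] [g _ <-]].
apply: closing_classesJ; first exact: cov_projP.
apply/closing_classE; first exact: cov_projP.
by apply/pullback_closes_up; exact: trivial_closes_up.
Qed.

(** * The covering associated with an action of the fundamental group *)

(** Both paths run along [g] between the same parameters; interpolating the parameters linearly
    gives the homotopy. *)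
Lemma homotopic_line (R : realType) (T : topologicalType) (x y : T)
    (q r : {path (unitI R) from x to y}) (g : R -> T) (phi psi : unitI R -> R) :
  continuous g -> continuous phi -> continuous psi ->
  (forall t, q t = g (phi t)) -> (forall t, r t = g (psi t)) ->
  phi zero = psi zero -> phi one = psi one -> homotopic q r.
Proof.
move=> cg cphi cpsi qE rE pp0 pp1.
exists (fun z => g ((1 - ival z.2) * phi z.1 + ival z.2 * psi z.1)); split=> /=.
- apply: (continuous_compT _ cg); cont; first by apply: continuous_compT cphi; cont.
  by apply: continuous_compT cpsi; cont.
- by move=> t; rewrite ival0 subr0 mul1r mul0r addr0 qE.
- by move=> t; rewrite ival1 subrr mul0r mul1r add0r rE.
- by move=> s; rewrite -pp0 -mulrDl subrK mul1r -qE path_zero.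
- by move=> s; rewrite -pp1 -mulrDl subrK mul1r -qE path_one.
Qed.

Lemma range_concat (R : realType) (T : topologicalType) (x y z : T)
    (q : {path (unitI R) from x to y}) (r : {path (unitI R) from y to z})
    (V : set T) :
  range q `<=` V -> range r `<=` V -> range (concat q r) `<=` V.
Proof.
move=> qV rV _ [t _ <-]; rewrite /concat; case: ifP => _.
  by apply: qV; exists (clamp (2 * ival t)).
by apply: rV; exists (clamp (2 * ival t - 1)).
Qed.

Lemma range_reverse (R : realType) (T : topologicalType) (x y : T)
    (q : {path (unitI R) from x to y}) (V : set T) :
  range q `<=` V -> range (reverse q) `<=` V.
Proof. by move=> qV _ [t _ <-]; apply: qV; exists (clamp (1 - ival t)). Qed.

Lemma homotopic_from_loop (R : realType) (T : topologicalType) (x y : T)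
    (q r : {path (unitI R) from x to y}) :
  homotopic (concat q (reverse r)) (cst_path R x) -> homotopic q r.
Proof.
move=> qr.
apply: (homotopic_trans (homotopic_sym (concat_pcst q))).
apply: (homotopic_trans
  (homotopic_concat (homotopic_refl q) (homotopic_sym (reverse_concat r)))).
apply: (homotopic_trans (homotopic_sym (concat_assoc q (reverse r) r))).
apply: (homotopic_trans (homotopic_concat qr (homotopic_refl r))).
exact: concat_cstp.
Qed.

Section Holonomy.
Variables (R : realType) (Y : topologicalType) (y0 : Y).
Local Notation I := (unitI R).
Variable c : forall y, {path I from y0 to y}.

(** The chosen paths [c] turn any path into a loop at [y0]; on homotopy classes this is a functor
    from the fundamental groupoid to the fundamental group. *)
Definition hol (y z : Y) (q : {path I from y to z}) : pi1 R y0 :=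
  pi1_class (concat (concat (c y) q) (reverse (c z))).

Lemma hol_homotopic (y z : Y) (q r : {path I from y to z}) :
  homotopic q r -> hol q = hol r.
Proof.
move=> qr; apply/pi1_classP; apply: homotopic_concat (homotopic_refl _).
exact: homotopic_concat (homotopic_refl _) qr.
Qed.

(** The type of a path depends on its ends; this handles ends that are equal but not convertible. *)
Lemma hol_ext (y z z' : Y) (q : {path I from y to z}) (r : {path I from y to z'}) :
  z = z' -> q =1 r -> hol q = hol r.
Proof. by move=> zz'; subst z' => /path_eqP ->. Qed.

Lemma hol_cst (y : Y) : hol (cst_path R y) = 1%g.
Proof.
apply/pi1_classP.
apply: (homotopic_trans
  (homotopic_concat (concat_pcst (c y)) (homotopic_refl (reverse (c y))))).
exact: concat_reverse.
Qed.

(** The inner [reverse (c y)] and [c y] cancel. *)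
Lemma hol_concat (x y z : Y) (q : {path I from x to y}) (r : {path I from y to z}) :
  hol (concat q r) = (hol q * hol r)%g.
Proof.
rewrite [RHS]pi1_mulE; apply/pi1_classP/homotopic_sym.
set cq := concat (c x) q; set r' := reverse (c z).
apply: (homotopic_trans (concat_assoc cq (reverse (c y)) (concat (concat (c y) r) r'))).
apply: (@homotopic_trans _ _ _ _ (concat cq (concat r r'))).
  apply: homotopic_concat; first exact: homotopic_refl.
  apply: (homotopic_trans
    (homotopic_sym (concat_assoc (reverse (c y)) (concat (c y) r) r'))).
  apply: homotopic_concat (homotopic_refl _).
  apply: (homotopic_trans (homotopic_sym (concat_assoc (reverse (c y)) (c y) r))).
  apply: (homotopic_trans
    (homotopic_concat (reverse_concat (c y)) (homotopic_refl r))).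
  exact: concat_cstp.
apply: (homotopic_trans (homotopic_sym (concat_assoc cq r r'))).
apply: homotopic_concat (homotopic_refl _).
exact: concat_assoc.
Qed.

(** [c y0] need not be the constant path, so a loop is only sent to a conjugate of its class, which
    is harmless for normal subgroups. *)
Lemma hol_loop (q : {path I from y0 to y0}) :
  hol q = (pi1_class (c y0) * pi1_class q * (pi1_class (c y0))^-1)%g.
Proof.
by rewrite [(_^-1)%g]pi1_invE [X in (X * _)%g]pi1_mulE [RHS]pi1_mulE.
Qed.

End Holonomy.

(* The right [pi1]-set [A] spread over [Y]: the point [(y, a)] stands for the
   class of [(c y, a)], and a path [q] out of [y] carries it to
   [act a (hol q)]. *)
Definition twisted (R : realType) (Y : topologicalType) (y0 : Y)
  (c : forall y, {path (unitI R) from y0 to y}) (A : choiceType)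
  (act : A -> pi1 R y0 -> A) : Type := (Y * A)%type.

Section Twisted.
Variables (R : realType) (Y : topologicalType) (y0 : Y).
Local Notation I := (unitI R).
Variable c : forall y, {path I from y0 to y}.
Variables (A : choiceType) (act : A -> pi1 R y0 -> A).
Hypothesis act1 : forall a, act a 1%g = a.
Hypothesis actM : forall a g h, act a (g * h)%g = act (act a g) h.
Hypothesis lY : locally_path_connected R Y.
Hypothesis sY : semilocally_simply_connected R Y.
Local Notation hol := (hol c).
Local Notation tw := (twisted c act).

(* This topology needs no choice of simply connected open sets; these only
   enter when the sheets are shown to be homeomorphic to their images. *)
Definition twisted_open (W : set tw) : Prop :=
  forall y a, W (y, a) -> exists2 V : set Y, open_nbhs y V &
    forall z (q : {path I from y to z}), range q `<=` V ->
      W (z, act a (hol q)).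

Let twisted_openT : twisted_open setT.
Proof. by move=> y a _; exists setT => //; exact: open_nbhsT. Qed.

Let twisted_openI : setI_closed twisted_open.
Proof.
move=> W1 W2 o1 o2 y a [/o1[V1 oV1 h1] /o2[V2 oV2 h2]].
exists (V1 `&` V2); first exact: open_nbhsI.
by move=> z q; rewrite subsetI => -[q1 q2]; split; [exact: h1|exact: h2].
Qed.

Let twisted_open_bigU (K : Type) (W : K -> set tw) :
  (forall i, twisted_open (W i)) -> twisted_open (\bigcup_i W i).
Proof.
move=> oW y a [i _ /oW[V oV h]]; exists V => // z q qV.
by exists i => //; exact: h.
Qed.

HB.instance Definition _ := Choice.copy tw (Y * A)%type.
HB.instance Definition _ := isOpenTopological.Build tw
  twisted_openT twisted_openI twisted_open_bigU.

Lemma twisted_openE (W : set tw) : open W = twisted_open W.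
Proof. by []. Qed.

Definition twisted_proj (e : tw) : Y := e.1.

Lemma twisted_proj_continuous : continuous twisted_proj.
Proof.
apply/continuousP => U oU; rewrite twisted_openE => y a Uy.
exists U => // z q qU; apply: qU; exists one => //; exact: path_one.
Qed.

Lemma actK g : cancel (act^~ g) (act^~ (g^-1)%g).
Proof. by move=> a; rewrite -actM mulgV act1. Qed.

Lemma actVK g : cancel (act^~ (g^-1)%g) (act^~ g).
Proof. by move=> a; rewrite -actM mulVg act1. Qed.

Section Sheets.
Variables (y : Y) (V : set Y).
Hypotheses (oV : open V) (Vy : V y) (cV : path_connected R V).
Hypothesis sV : forall q : {path I from y to y},
  range q `<=` V -> homotopic q (cst_path R y).

(** The value [1] is a default for points not reached from [y] inside [V]; there are none in [V]
    itself. *)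
Definition hol_to (w : Y) : pi1 R y0 :=
  if pselect (exists q : {path I from y to w}, range q `<=` V) is left ex
  then hol (sval (cid ex)) else 1%g.

(** Two paths inside [V] with the same ends differ by a loop inside [V], which is null-homotopic by
    [sV]. *)
Lemma hol_toE w (q : {path I from y to w}) : range q `<=` V -> hol_to w = hol q.
Proof.
move=> qV; rewrite /hol_to; case: pselect => [ex|[]]; last by exists q.
apply: hol_homotopic; apply: homotopic_from_loop; apply: sV.
apply: range_concat; first exact: (svalP (cid ex)).
exact: range_reverse.
Qed.

Definition sheet (a : A) : set tw := [set e | V e.1 /\ e.2 = act a (hol_to e.1)].

Lemma sheet_open a : open (sheet a).
Proof.
rewrite twisted_openE => w b [/= Vw ->]; exists V => // z r rV.
have [q qV] := cV Vy Vw.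
split; first by apply: rV; exists one => //=; exact: path_one.
by rewrite /= (hol_toE qV) (hol_toE (range_concat qV rV)) hol_concat actM.
Qed.

Let sigma (a : A) (w : Y) : tw := (w, act a (hol_to w)).

(** A path inside [V] from [y] to [w] is prolonged by one in a small [V2]; the label at the new end
    is the label at [w] moved by the holonomy of the short piece, as the topology demands. *)
Lemma sheet_section_continuous a w : V w -> {for w, continuous (sigma a)}.
Proof.
move=> Vw N; rewrite nbhsE => -[W [oW Ww] WN].
have [V1 oV1 h1] := oW _ _ Ww.
have [V2 [oV2 V21 cV2]] := lY (open_nbhs_nbhs (open_nbhsI oV1 (conj oV Vw))).
change (nbhs w (sigma a @^-1` N)).
apply: filterS (open_nbhs_nbhs oV2) => z V2z; apply: WN.
have [q qV] := cV Vy Vw; have [r rV] := cV2 w z oV2.2 V2z.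
have := subset_trans rV V21; rewrite subsetI => -[r1 rV'].
have := h1 z r r1; rewrite -actM (hol_toE qV) -hol_concat.
by rewrite -(hol_toE (range_concat qV rV')).
Qed.

Lemma twisted_evenly_covered : evenly_covered twisted_proj V.
Proof.
exists (range sheet); split.
- by move=> _ [a _ <-]; exact: sheet_open.
- move=> _ _ [a _ <-] [b _ <-] [e [[_ ea] [_ eb]]]; congr sheet.
  by apply: (can_inj (actK (hol_to e.1))); rewrite -ea.
- rewrite predeqE => e; split=> [[_ [a _ <-] []]//|Ve].
  (* The label of [e] is carried back to [y] inside [V] to find its sheet. *)
  exists (sheet (act e.2 (hol_to e.1)^-1%g)); first by eexists.
  by split=> //; rewrite actVK.
- move=> _ [a _ <-].
  have inV (e : set_type (sheet a)) : twisted_proj (set_val e) \in V.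
    by rewrite inE; have [] := set_valP e.
  have inS (w : set_type V) : sigma a (set_val w) \in sheet a.
    by rewrite inE; split=> //; exact: (set_valP w).
  exists (fun e => set_in (inV e)) => //; split.
    apply: continuous_set_type.
    apply: (continuous_compT _ twisted_proj_continuous).
    exact: continuous_set_val.
  exists (fun w => set_in (inS w)); split.
  + apply: continuous_set_type => w /=.
    apply: (@continuous_comp _ _ _ (@set_val Y V) (sigma a)).
      exact: continuous_set_val.
    by apply: sheet_section_continuous; exact: (set_valP w).
  + move=> e; apply: val_inj => /=; have [_ e2] := set_valP e.
    by rewrite [RHS]surjective_pairing [X in (_, X)]e2.
  + by move=> w; exact: val_inj.
Qed.

End Sheets.

Lemma twisted_covering : is_covering twisted_proj.
Proof.
split; first exact: twisted_proj_continuous.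
move=> y; have [U Uy sU] := sY y.
have [V [oV VU cV]] := lY Uy; exists V => //.
apply: (@twisted_evenly_covered y) => //; [exact: oV.1|exact: oV.2|].
by move=> q qV; apply: sU; exact: subset_trans VU.
Qed.

Definition cov_twisted : cov Y := Cov twisted_covering.

(** At time [u] the lift carries [a] moved by the holonomy of the initial segment [sub u] of [q]. *)
Lemma twisted_lift (y z : Y) (q : {path I from y to z}) (a : A) :
  path_lift twisted_proj q ((y, a) : tw) ((z, act a (hol q)) : tw).
Proof.
pose g := q \o @clamp R.
have cg : continuous g.
  by apply: continuous_compT; [exact: clamp_continuous|exact: cts_fun].
have gE u : g (ival u) = q u by rewrite /g /= ivalK.
have g0 : g 0 = y by rewrite /g /= clamp_le0// path_zero.
have cseg (s t : R) : continuous (fun v : I => (1 - ival v) * s + ival v * t).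
  by cont.
have cseg' (s t : R) : continuous (fun v : I => g ((1 - ival v) * s + ival v * t)).
  exact: continuous_compT (cseg s t) cg.
have sub0 (s : R) (t : I) (x : Y) : g s = x ->
    g ((1 - ival zero) * s + ival zero * ival t) = x.
  by rewrite ival0 subr0 mul1r mul0r addr0.
have sub1 (s : R) (t : I) : g ((1 - ival one) * s + ival one * ival t) = q t.
  by rewrite ival1 subrr mul0r mul1r add0r.
pose sub u : {path I from y to q u} :=
  mk_path (cseg' 0 (ival u)) (sub0 0 u y g0) (sub1 0 u).
pose h u : tw := (q u, act a (hol (sub u))).
have h0 : h zero = (y, a).
  rewrite /h (@hol_ext _ _ _ _ _ _ _ (sub zero) (cst_path R y));
    rewrite ?hol_cst ?act1 ?path_zero//.
  by move=> t; rewrite /= /mk_path ival0 !mulr0 addr0.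
have h1 : h one = (z, act a (hol q)).
  rewrite /h (@hol_ext _ _ _ _ _ _ _ (sub one) q) ?path_one//.
  by move=> t; rewrite /= /mk_path ival1 mulr0 mulr1 add0r.
suff ch : continuous h by exists (mk_path ch h0 h1).
move=> u N; rewrite nbhsE => -[W [oW Wu] WN].
have [V oV hV] := oW _ _ Wu.
have : nbhs (ival u) (g @^-1` V).
  by apply: cg; rewrite gE; exact: open_nbhs_nbhs.
move=> /nbhs_ballP[e /= e0 eV].
have : nbhs u (@ival R @^-1` ball (ival u) e).
  by apply: ival_continuous; exact: nbhsx_ballx.
change (nbhs u (@ival R @^-1` ball (ival u) e) -> nbhs u (h @^-1` N)).
apply: filterS => t /= ut; apply: WN.
(* [r] runs along [q] from time [u] to time [t]; convex combinations of the two times stay in the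
   ball around [ival u]. *)
pose r : {path I from q u to q t} :=
  mk_path (cseg' (ival u) (ival t)) (sub0 (ival u) t (q u) (gE u)) (sub1 (ival u) t).
have rV : range r `<=` V.
  move=> _ [v _ <-]; apply: eV; move: ut; rewrite /ball /= !ltr_distlC.
  move=> /andP[ut1 ut2].
  have v0 := ival_ge0 v; have v1 := ival_le1 v.
  by apply/andP; split; nra.
have := hV _ _ rV; rewrite -actM -hol_concat /h.
congr (W (_, act _ _)); apply: hol_homotopic.
(* [sub u] followed by [r], and [sub t], both follow [g] from time [0] to time [ival t]; [phi]
   parametrizes the former. *)
pose phi (v : I) : R :=
  if ival v <= 2^-1 then ival (clamp (2 * ival v)) * ival u
  else (1 - ival (clamp (2 * ival v - 1))) * ival u +
       ival (clamp (2 * ival v - 1)) * ival t.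
apply: (@homotopic_line _ _ _ _ _ _ g phi (fun v => ival v * ival t)) => //.
- apply: continuous_paste; [by cont|by cont|by cont|].
  by move=> v ->; rewrite divff// subrr clamp_ge1// clamp_le0// ival0 ival1; ring.
- by cont.
- move=> v; rewrite /= /concat /phi; case: ifP => _ /=; last by [].
  by rewrite /mk_path mulr0 add0r.
- by move=> v; rewrite /= /mk_path mulr0 add0r.
- by rewrite /phi ival0 invr_ge0 ler0n mulr0 clamp_le0// ival0 !mul0r.
- rewrite /phi ival1 ifF; last by apply/negbTE; rewrite -ltNge; lra.
  by rewrite clamp_ge1 ?ival1; [ring|lra].
Qed.

End Twisted.

(** * The action on unions of cosets *)

Section CosetUnions.
Variables (G : groupType) (N : set G).
Hypothesis subN : is_subgroup N.
Hypothesis normN : forall a g, N a -> N (a ^ g)%g.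

(** For a subgroup [N] these are the unions of cosets [N x]. Keeping all of them, not only single
    cosets, avoids a quotient, and [N] itself is still one of the points. *)
Definition left_invariant : set (set G) :=
  [set C | forall n x, N n -> C x -> C (n * x)%g].

Lemma translate_subproof (C : set_type left_invariant) (g : G) :
  [set x | set_val C (x * g^-1)%g] \in left_invariant.
Proof.
rewrite inE => n x Nn /= Cx; rewrite -mulgA.
exact: (set_valP C).
Qed.

(** The right translate [C g]; the inverse makes this a right action. *)
Definition translate (C : set_type left_invariant) (g : G) :
  set_type left_invariant := set_in (translate_subproof C g).

Lemma translate1 C : translate C 1%g = C.
Proof. by apply/val_inj/funext => x /=; rewrite invg1 mulg1. Qed.

Lemma translateM C g h : translate C (g * h)%g = translate (translate C g) h.
Proof. by apply/val_inj/funext => x /=; rewrite invgM mulgA. Qed.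

(** [x n = (x n x^-1) x], where [x n x^-1] lies in [N] by normality and is absorbed by [C]. *)
Lemma translate_normal C n : N n -> translate C n = C.
Proof.
have [_ _ NV] := subN.
have NJ m x : N m -> N (x * m * x^-1)%g.
  by move=> /(@normN _ x^-1%g); rewrite /conjg invgK mulgA.
move=> Nn; apply/val_inj/seteqP; split=> x /= Cx.
- rewrite (_ : x = (x * n * x^-1) * (x * n^-1))%g; last first.
    by rewrite !mulgA mulgVK mulgK.
  by apply: (set_valP C) => //; exact: NJ.
- rewrite (_ : x * n^-1 = (x * n^-1 * x^-1) * x)%g; last by rewrite mulgVK.
  by apply: (set_valP C) => //; exact/NJ/NV.
Qed.

Lemma left_invariant_subgroup : N \in left_invariant.
Proof. by have [_ NM _] := subN; rewrite inE => n x; exact: NM. Qed.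

Lemma translate_stab g :
  translate (set_in left_invariant_subgroup) g = set_in left_invariant_subgroup ->
  N g.
Proof.
have [N1 _ NV] := subN; move=> Ng.
have : N (1 * g^-1)%g.
  change (set_val (translate (set_in left_invariant_subgroup) g) 1%g).
  by rewrite Ng.
by rewrite mul1g => /NV; rewrite invgK.
Qed.

End CosetUnions.

Lemma nullity_zero_contranormal (R : realType) (X Y : topologicalType)
    (f : continuousType X Y) (x0 : X) :
  connected [set: X] -> locally_path_connected R X ->
  connected [set: Y] -> locally_path_connected R Y ->
  semilocally_simply_connected R Y ->
  nullity_zero f -> contranormal (range (@pi1_map R X Y f x0)).
Proof.
move=> cX lX cY lY sY nf.
pose cx x := inhabited_witness (connected_paths x0 cX lX x).
pose c y := inhabited_witness (connected_paths (f x0) cY lY y).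
rewrite /contranormal; set N := normal_closure _.
have subN : is_subgroup N := normal_closure_subgroup _.
have normN a g : N a -> N (a ^ g)%g := @normal_closureJ _ _ a g.
pose E := cov_twisted c (@translate1 _ N) (@translateM _ N) lY sY.
have holN q : N (pi1_class q) -> N (hol c q).
  move=> Nq; rewrite hol_loop; set d := pi1_class (c _).
  by have := normN _ d^-1%g Nq; rewrite /conjg invgK mulgA.
have tE : trivial_cov E.
  apply: nf; apply: (trivial_of_closed_loops lX cx) => q.
  apply/pullback_closes_up => -[y C] /= yE.
  rewrite /twisted_proj /= in yE; subst y.
  have := twisted_lift c (@translate1 _ N) (@translateM _ N) (f \o q) C.
  rewrite translate_normal//; apply: holN; apply: sub_normal_closure.
  by exists (pi1_class q) => //; rewrite pi1_mapE.
rewrite -subTset => a _.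
rewrite -[a]pi1_class_repr; set q := repr a.
pose N0 := set_in (left_invariant_subgroup subN).
(* Triviality closes the lift of [q] at the point [N], whereas the explicit lift ends at the
   translate of [N] by [hol c q]; uniqueness of lifts equates the two ends. *)
have l1 := trivial_closes_up q tE (e := (f x0, N0) : E) erefl.
have l2 := twisted_lift c (@translate1 _ N) (@translateM _ N) q N0.
have /(congr1 snd) := path_lift_unique (cov_projP E) l2 l1.
move=> /translate_stab; rewrite hol_loop; set d := pi1_class (c _) => Nq.
by have := normN _ d Nq; rewrite /conjg !mulgA mulVg mul1g mulgVK.
Qed.

Theorem corollary4p2 (R : realType) (X Y : topologicalType)
    (f : continuousType X Y) (x0 : X) :
  connected [set: X] ->
  locally_path_connected R X ->
  semilocally_simply_connected R X ->
  connected [set: Y] ->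
  locally_path_connected R Y ->
  semilocally_simply_connected R Y ->
  nullity_zero f <-> contranormal (range (@pi1_map R X Y f x0)).
Proof.
move=> cX lX _ cY lY sY; split; first exact: nullity_zero_contranormal.
exact: contranormal_nullity_zero.
Qed.
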